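(* Let $\Gamma$ be a singular branch of plane curve. Then $\Lambda_\Gamma$ is a $\mathcal C$-collection; that is, $\Lambda_\Gamma+\mathcal S_\Gamma\subset\Lambda_\Gamma$, and for every $m\in\Lambda_\Gamma$ and all $1\le j\le k\le g$ with $m\le\overline\beta_j$ one has $m+\overline\beta_k-\overline\beta_j\in\Lambda_\Gamma$.
   Context: Let $\Gamma$ be a singular irreducible germ of holomorphic curve at $0\in\mathbb C^2$ with Puiseux parametrization $\Gamma(t)=(t^n,\sum_{\beta\ge\beta_1}a_{\beta,\Gamma}t^\beta)$, where $n\ge2$ is its multiplicity and $\beta_1<\dots<\beta_g$ ($g\ge1$) are its Puiseux characteristic exponents. Put $e_0=n$, $e_j=\gcd(e_{j-1},\beta_j)$, $n_j=e_{j-1}/e_j$ for $1\le j\le g$. Define $\overline\beta_1=\beta_1$ and $\overline\beta_j=n_{j-1}\overline\beta_{j-1}-\beta_{j-1}+\beta_j$ for $2\le j\le g$. For $f\in\mathbb C[[x,y]]$ let $\nu_\Gamma(f)=\mathrm{ord}_t f(\Gamma(t))$; for a (formal) 1-form $\omega=a\,dx+b\,dy$ write $\Gamma^*\omega=h(t)\,dt$ and set $\nu_\Gamma(\omega)=\mathrm{ord}_t h+1$ ($=\infty$ if $h\equiv0$). The semigroup of $\Gamma$ is $\mathcal S_\Gamma=\{\nu_\Gamma(f):f\in\mathbb C\{x,y\},\ f(0)=0\}$; it is minimally generated by $n,\overline\beta_1,\dots,\overline\beta_g$. Let $\Lambda_\Gamma=\{\nu_\Gamma(\omega):\omega \text{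 a germ of holomorphic 1-form at }0\}\setminus\{\infty\}\subset\mathbb Z_{>0}$. *)

(* Defs.v *)
From mathcomp Require Import all_boot all_algebra.
From mathcomp Require Import reals.
From mathcomp.real_closed Require Import complex.

Set Implicit Arguments.
Unset Strict Implicit.
Unset Printing Implicit Defensive.
Import GRing.Theory Num.Theory.
Local Open Scope ring_scope.

Section Defs.
Variable R : realType.
Local Notation C := R[i].

(* univariate formal power series in t: k |-> coefficient of t^k *)
Definition ps := nat -> C.
(* bivariate formal power series in x,y: (i,j) |-> coefficient of x^i y^j *)
Definition ps2 := nat -> nat -> C.

Definition ps_one : ps := fun k => (k == 0%N)%:R.
Definition ps_mul (f g : ps) : ps :=
  fun k => \sum_(i < k.+1) f i * g (k - i)%N.
Definition ps_exp (f : ps) (m : nat) : ps := iter m (ps_mul f) ps_one.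
Definition ps_add (f g : ps) : ps := fun k => f k + g k.
Definition ps_deriv (f : ps) : ps := fun k => f k.+1 *+ k.+1.

(* substitution f(x(t), y(t)) of formal series x, y without constant term:
   only monomials x^i y^j with i + j <= k contribute to t^k. *)
Definition ps_subst (f : ps2) (x y : ps) : ps :=
  fun k => \sum_(i < k.+1) \sum_(j < k.+1)
             f i j * ps_mul (ps_exp x i) (ps_exp y j) k.

Definition convergent (a : ps) : Prop :=
  exists r M : C, 0 < r /\ forall k, `|a k| * r ^+ k <= M.
Definition convergent2 (f : ps2) : Prop :=
  exists r M : C, 0 < r /\ forall i j, `|f i j| * r ^+ (i + j) <= M.

Definition ps_ord (h : ps) (m : nat) : Prop :=
  h m != 0 /\ forall i, (i < m)%N -> h i = 0.

(* the parametrization Gamma(t) = (t^n, y(t)) *)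
Definition tpow (n : nat) : ps := fun k => (k == n)%:R.

Definition semigroup (n : nat) (y : ps) (m : nat) : Prop :=
  exists f : ps2, convergent2 f /\ f 0%N 0%N = 0 /\
    ps_ord (ps_subst f (tpow n) y) m.

(* Lambda_Gamma = { nu_Gamma(a dx + b dy) : a, b in C{x,y} } \ {oo},
   where Gamma^*(a dx + b dy) = h(t) dt and nu = ord_t h + 1 *)
Definition diff_values (n : nat) (y : ps) (m : nat) : Prop :=
  exists a b : ps2, convergent2 a /\ convergent2 b /\
    exists o, m = o.+1 /\
      ps_ord (ps_add (ps_mul (ps_subst a (tpow n) y) (ps_deriv (tpow n)))
                     (ps_mul (ps_subst b (tpow n) y) (ps_deriv y))) o.

End Defs.

Fixpoint char_e (n : nat) (beta : nat -> nat) (j : nat) : nat :=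
  if j is j'.+1 then gcdn (char_e n beta j') (beta j) else n.

Definition char_n (n : nat) (beta : nat -> nat) (j : nat) : nat :=
  (char_e n beta j.-1 %/ char_e n beta j)%N.

Fixpoint betabar (n : nat) (beta : nat -> nat) (j : nat) : nat :=
  match j with
  | 0 => 0
  | 1 => beta 1%N
  | (j'.+1) as j1 =>
      (char_n n beta j' * betabar n beta j' + beta j1 - beta j')%N
  end.

Definition puiseux_char_exps (R : realType) (n : nat) (y : ps R)
    (g : nat) (beta : nat -> nat) : Prop :=
  (1 <= g)%N /\
  char_e n beta g = 1%N /\
  (forall j, (1 <= j <= g)%N ->
     y (beta j) != 0 /\ ~~ (char_e n beta j.-1 %| beta j)%N /\
     (forall k, (k < beta j)%N -> y k != 0 -> (char_e n beta j.-1 %| k)%N)).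

(* Main.v *)
(** For 0 <= j < g let E_j be the module of 1-forms A dx + B dy with deg_y A, deg_y B < N = n / e_j,
    and let V_j be the set of their values along the branch.  The core is a duality: if e_j | v then
    exactly one of v, b - v lies in V_j, where b = betabar_(j+1) and 0 <= v <= b; and v + v' <> b for all
    v, v' in V_j.  Since every form of value less than betabar_(j+1) can be reduced to E_j modulo
    the equation of the truncated branch, a value m < betabar_j gives betabar_j - m notin V_(j-1), hence
    notin V_j, hence m + betabar_(j+1) - betabar_j in V_j.

    For the duality, let f be the equation of the truncation y_j of the branch below beta_(j+1).
    Lagrange interpolation at the conjugates of y_j shows that the value of a form in E_j is the minimum of
    its value along y_j, a multiple of e_j, and of beta_(j+1) + ord B(y_j), which is not.  The
    bilinear form (w, w') |-> coefficient of y^(N-1) in (w /\ w') mod f is perfect on E_j, and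
    Lagrange interpolation again bounds its order from below by (v + v' - b - n) / n, with equality when
    e_j divides v and v + v' = b mod n.  So a
    basis of E_j of minimal values is matched in pairs of sum b + n, by expanding the Gram
    determinant.

    All values are finite, so the forms and the parametrization can be truncated to polynomials. *)
From HB Require Import structures.
Require Import Defs.
From mathcomp Require Import all_boot all_order all_algebra all_fingroup all_solvable all_field.
From mathcomp Require Import reals boolp.
From mathcomp Require Import zify ring.
From mathcomp.real_closed Require Import complex.

Set Implicit Arguments.
Unset Strict Implicit.
Unset Printing Implicit Defensive.
Import Order.TTheory GRing.Theory Num.Theory.
Local Open Scope ring_scope.

(** * Orders of polynomials at the origin *)

Section Orders.
Variable F : fieldType.
Implicit Types (p q : {poly F}) (c d u : F) (k l : nat).

Definition vge k p := forall i, (i < k)%N -> p`_i = 0.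
(** The value [c = 0] is allowed, so that leading terms add and multiply without a discussion of
    cancellation. *)
Definition lead k c p := vge k p /\ p`_k = c.

Lemma vgeP k p : vge k p <-> exists q, p = 'X^k * q.
Proof.
split=> [h | [q ->] i ik]; last by rewrite coefXnM ik.
exists (drop_poly k p); apply/polyP=> i; rewrite coefXnM coef_drop_poly.
by case: ltnP => [/h //|ki]; rewrite subnK.
Qed.

Lemma leadP k c p : lead k c p <-> exists2 q, p = 'X^k * q & q`_0 = c.
Proof.
split=> [[/vgeP[q ->]]|[q -> <-]].
  by rewrite coefXnM ltnn subnn => qc; exists q.
by split; [apply/vgeP; exists q | rewrite coefXnM ltnn subnn].
Qed.

Lemma vge_lead k p : vge k p -> lead k p`_k p. Proof. by []. Qed.

Lemma vge0 p : vge 0 p. Proof. by []. Qed.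

Lemma vge_le k l p : (k <= l)%N -> vge l p -> vge k p.
Proof. by move=> kl h i ik; apply: h; apply: leq_trans kl. Qed.

Lemma vgeSr k p : vge k p -> p`_k = 0 -> vge k.+1 p.
Proof. by move=> h pk i; rewrite ltnS leq_eqVlt => /predU1P[->|/h]. Qed.

Lemma vge_lead0 k l p : (k < l)%N -> vge l p -> lead k 0 p.
Proof. by move=> kl h; split; [apply: vge_le h; apply: ltnW | apply: h]. Qed.

Lemma leadM k l c d p q : lead k c p -> lead l d q -> lead (k + l) (c * d) (p * q).
Proof.
move=> /leadP[p' -> <-] /leadP[q' -> <-]; apply/leadP; exists (p' * q').
  by rewrite exprD; ring.
by rewrite coef0M.
Qed.

Lemma vgeM k l p q : vge k p -> vge l q -> vge (k + l) (p * q).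
Proof. by move=> /vge_lead hp /vge_lead hq; case: (leadM hp hq). Qed.

Lemma leadD k c d p q : lead k c p -> lead k d q -> lead k (c + d) (p + q).
Proof.
move=> [hp <-] [hq <-]; split; last by rewrite coefD.
by move=> i ik; rewrite coefD hp // hq // addr0.
Qed.

Lemma leadN k c p : lead k c p -> lead k (- c) (- p).
Proof. by move=> [hp <-]; split=> [i ik|]; rewrite coefN // hp // oppr0. Qed.

Lemma leadB k c d p q : lead k c p -> lead k d q -> lead k (c - d) (p - q).
Proof. by move=> hp hq; apply: leadD => //; apply: leadN. Qed.

Lemma vgeB k p q : vge k p -> vge k q -> vge k (p - q).
Proof. by move=> hp hq i ik; rewrite coefB hp // hq // subr0. Qed.

Lemma vgeD k p q : vge k p -> vge k q -> vge k (p + q).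
Proof. by move=> hp hq i ik; rewrite coefD hp // hq // addr0. Qed.

Lemma lead_sum (I : finType) (P : pred I) k (c : I -> F) (p : I -> {poly F}) :
  (forall i, P i -> lead k (c i) (p i)) ->
  lead k (\sum_(i | P i) c i) (\sum_(i | P i) p i).
Proof.
move=> h; split=> [j jk|]; rewrite coef_sum.
  by apply: big1 => i /h [+ _]; apply.
by apply: eq_bigr => i /h [].
Qed.

Lemma vge_sum (I : finType) (P : pred I) k (p : I -> {poly F}) :
  (forall i, P i -> vge k (p i)) -> vge k (\sum_(i | P i) p i).
Proof.
by move=> h j jk; rewrite coef_sum; apply: big1 => i /h; apply.
Qed.

Lemma lead_prod (I : finType) (P : pred I) (k : I -> nat) (c : I -> F)
    (p : I -> {poly F}) :
  (forall i, P i -> lead (k i) (c i) (p i)) ->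
  lead (\sum_(i | P i) k i) (\prod_(i | P i) c i) (\prod_(i | P i) p i).
Proof.
move=> h.
apply: (big_rec3 (fun m c p => lead m c p)) => [|i m d q Pi IH].
  by split=> //; rewrite coef1.
by apply: leadM IH; apply: h.
Qed.

Lemma leadXn k : lead k 1 ('X^k : {poly F}).
Proof. by apply/leadP; exists 1; rewrite ?mulr1 // coef1. Qed.

Lemma vge_cancel k l c p q : lead k c p -> c != 0 -> vge (k + l) (p * q) -> vge l q.
Proof.
move=> /leadP[r -> <-] r0 h; elim: l h => // l IH h.
have hl : vge l q by apply: IH; apply: vge_le h; rewrite leq_add2l.
apply: vgeSr => //; apply/eqP.
have [_] := leadM (leadXn k) (leadM (vge_lead (vge0 r)) (vge_lead hl)).
rewrite mulrA h ?addnS // => /esym/eqP.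
by rewrite mul1r mulf_eq0 (negPf r0).
Qed.

Lemma lead_neq0 k c p : lead k c p -> c != 0 -> p != 0.
Proof. by move=> [_ <-]; apply: contraNneq => ->; rewrite coef0. Qed.

(** The Euler derivation t d/dt, which does not lower orders and commutes with [rescale]. *)
Definition theta p := 'X * p^`().

Lemma coef_theta p i : (theta p)`_i = p`_i *+ i.
Proof. by rewrite /theta coefXM; case: i => [|i]; rewrite //= coef_deriv. Qed.

Lemma lead_theta k c p : lead k c p -> lead k (c *+ k) (theta p).
Proof.
move=> [h <-]; split=> [i ik|]; rewrite coef_theta //.
by rewrite h // mul0rn.
Qed.

Lemma thetaB p q : theta (p - q) = theta p - theta q.
Proof. by rewrite /theta derivB mulrBr. Qed.

(** The substitution of u t for t. For [u] an n-th root of unity it carries a Puiseux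
    parametrization to a conjugate one. *)
Definition rescale u p := p \Po (u *: 'X).

HB.instance Definition _ u := GRing.RMorphism.copy (rescale u)
  (comp_poly (u *: 'X)).

Lemma coef_rescale u p i : (rescale u p)`_i = u ^+ i * p`_i.
Proof.
rewrite /rescale comp_polyE coef_sum.
under eq_bigr do rewrite exprZn !coefZ coefXn.
case: (ltnP i (size p)) => ip.
  rewrite (bigD1 (Ordinal ip)) //= eqxx mulr1 big1 ?addr0 1?mulrC // => j.
  rewrite -val_eqE /= => ji.
  by rewrite eq_sym (negPf ji) !mulr0.
rewrite nth_default // mulr0 big1 // => j _.
by rewrite gtn_eqF ?mulr0 // (leq_trans (ltn_ord j)).
Qed.

Lemma lead_rescale u k c p : lead k c p -> lead k (u ^+ k * c) (rescale u p).
Proof.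
move=> [h <-]; split=> [i ik|]; rewrite coef_rescale //.
by rewrite h // mulr0.
Qed.

Lemma vge_rescale u k p : vge k p -> vge k (rescale u p).
Proof. by move=> h i ik; rewrite coef_rescale h // mulr0. Qed.

Lemma rescale_theta u p : rescale u (theta p) = theta (rescale u p).
Proof. by apply/polyP=> i; rewrite !(coef_rescale, coef_theta) mulrnAr. Qed.

Lemma rescaleM u v p : rescale u (rescale v p) = rescale (v * u) p.
Proof. by apply/polyP=> i; rewrite !coef_rescale exprMn; ring. Qed.

Lemma rescale1 p : rescale 1 p = p.
Proof. by apply/polyP=> i; rewrite coef_rescale expr1n mul1r. Qed.

Definition inXe e p := forall k, p`_k != 0 -> (e %| k)%N.

Lemma inXeM e p q : inXe e p -> inXe e q -> inXe e (p * q).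
Proof.
move=> hp hq k; apply: contraR => ek; rewrite coefM big1 // => i _.
have [->|/hp ei] := eqVneq p`_i 0; first by rewrite mul0r.
have [->|/hq ej] := eqVneq q`_(k - i) 0; first by rewrite mulr0.
case/negP: ek; rewrite -(@subnKC i k) ?dvdn_add //.
by rewrite -ltnS.
Qed.

Lemma inXeD e p q : inXe e p -> inXe e q -> inXe e (p + q).
Proof.
move=> hp hq k; rewrite coefD; have [->|/hp //] := eqVneq p`_k 0.
by rewrite add0r => /hq.
Qed.

Lemma inXe_theta e p : inXe e p -> inXe e (theta p).
Proof.
move=> hp k; rewrite coef_theta => h; apply: hp.
by apply: contraNneq h => ->; rewrite mul0rn.
Qed.

Lemma inXe0 e : inXe e 0. Proof. by move=> k; rewrite coef0 eqxx. Qed.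

Lemma inXe1 e : inXe e 1.
Proof. by move=> k; rewrite coef1; case: k => //= k; rewrite eqxx. Qed.

Lemma inXe_compXn e n p : (0 < n)%N -> (e %| n)%N -> inXe e (p \Po 'X^n).
Proof.
move=> n0 en k; rewrite coef_comp_poly_Xn //.
by case: ifP => [nk _|]; rewrite ?eqxx //; apply: dvdn_trans nk.
Qed.

Lemma inXe_rescale e u p : inXe e p -> u ^+ e = 1 -> rescale u p = p.
Proof.
move=> hp ue; apply/polyP => k; rewrite coef_rescale.
have [->|/hp /dvdnP[q ->]] := eqVneq p`_k 0; first by rewrite mulr0.
by rewrite mulnC exprM ue expr1n mul1r.
Qed.

End Orders.

(** * Duality for forms of bounded degree *)

Section Duality.
Variable F : numFieldType.
Variables (n e N' : nat) (z : F) (y yj : {poly F}) (beta : nat) (lam : nat -> nat).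
Let N := N'.+1.
Hypothesis e_gt0 : (0 < e)%N.
Hypothesis nE : n = (e * N)%N.
Hypothesis zprim : n.-primitive_root z.
Hypothesis yj_e : inXe e yj.
Hypothesis yj0 : yj`_0 = 0.
(* [lam i] is the order of contact of the branch with the conjugate [yj (z^i t)] of its truncation,
   and [lam_pos] says that the logarithmic derivatives in [form_lagrange] do not cancel. *)
Hypothesis lam0 : lam 0%N = beta.
Hypothesis lam_lt : forall i, (0 < i < N)%N -> (lam i < beta)%N.
Hypothesis lam_e : forall i, (0 < i < N)%N -> (e %| lam i)%N.
Hypothesis beta_e : ~~ (e %| beta)%N.
Hypothesis contact : forall i, (i < N)%N ->
  exists2 c : F, c != 0 & lead (lam i) c (y - rescale (z ^+ i) yj).
Hypothesis contactj : forall i, (0 < i < N)%N ->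
  exists2 c : F, c != 0 & lead (lam i) c (yj - rescale (z ^+ i) yj).
Hypothesis lam_pos : forall u : F, u ^+ N = 1 ->
  \sum_(i < N) u ^+ i * (lam i)%:R != 0.

Implicit Types A B P H : {poly {poly F}}.

(** The outer variable of [A] stands for the coordinate y and the variable of its coefficients for
    the coordinate x, which becomes t^n. *)
Definition ev (x : {poly F}) A : {poly F} := (map_poly (comp_poly 'X^n) A).[x].
(* The pullback of [A dx + B dy] divided by [dt/t], so that its order is the value of the form. *)
Definition form_at (x : {poly F}) A B : {poly F} :=
  ev x A * ('X^n *+ n) + ev x B * theta x.

(** The [r i] are the conjugates of [yj], and [D i] is the derivative of [f] at [r i], of order
    [kap]. The order of [f] at [y] is [b], which will be a betabar. Since [M i] is [Pi / D i],
    multiplying by [Pi] clears the denominators of Lagrange interpolation. *)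
Local Notation r i := (rescale (z ^+ i) yj).
Let f : {poly {poly F}} := \prod_(i < N) ('X - (r i)%:P).
Let l (i : 'I_N) : {poly {poly F}} := \prod_(k < N | k != i) ('X - (r k)%:P).
Let D (i : 'I_N) := \prod_(k < N | k != i) (r i - r k).
Let L (i : 'I_N) := \prod_(k < N | k != i) (y - r k).
Let M (i : 'I_N) := \prod_(k < N | k != i) D k.
Let Pi := \prod_(k < N) D k.
Let kap := (\sum_(i < N | i != ord0) lam i)%N.
Let b := (\sum_(i < N) lam i)%N.

(** * Conjugates of the truncated branch and Lagrange interpolation *)

Lemma n_gt0 : (0 < n)%N. Proof. by rewrite nE muln_gt0 e_gt0. Qed.

Lemma bE : b = (beta + kap)%N.
Proof. by rewrite /b (bigD1 ord0) //= lam0. Qed.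

Lemma kap_e : (e %| kap)%N.
Proof.
apply: dvdn_sum => i i0; apply: lam_e.
by rewrite ltn_ord andbT lt0n.
Qed.

Lemma r_per : r N = r 0%N.
Proof.
rewrite expr0 rescale1; apply: (inXe_rescale yj_e).
by rewrite -exprM mulnC -nE prim_expr_order.
Qed.

Lemma rescale_r (i : nat) : rescale z (r i) = r i.+1.
Proof. by rewrite rescaleM exprSr. Qed.

(** Rescaling by [z] permutes the factors of [f] cyclically. *)
Lemma rescale_f : map_poly (rescale z) f = f.
Proof.
rewrite /f rmorph_prod /= big_ord_recr big_ord_recl /= mulrC; congr (_ * _).
  by rewrite rmorphB /= map_polyX map_polyC /= rescale_r r_per.
apply: eq_bigr => i _.
by rewrite rmorphB /= map_polyX map_polyC /= rescale_r /bump add1n.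
Qed.

Lemma fE (i : 'I_N) : f = ('X - (r i)%:P) * l i.
Proof. by rewrite /f (bigD1 i). Qed.

Lemma l_root (i k : 'I_N) : i != k -> (l i).[r k] = 0.
Proof.
move=> ik; rewrite /l (bigD1 k) 1?eq_sym //= hornerM hornerXsubC subrr.
by rewrite mul0r.
Qed.

Lemma l_diag i : (l i).[r i] = D i.
Proof.
by rewrite /l horner_prod; apply: eq_bigr => k _; rewrite hornerXsubC.
Qed.

Lemma D_deriv (i : 'I_N) : D i = f^`().[r i].
Proof.
rewrite (fE i) derivM derivXsubC mul1r hornerD hornerM hornerXsubC subrr.
by rewrite mul0r addr0 l_diag.
Qed.

(** By the invariance of [f], its derivatives at the conjugates are conjugate to each other. Hence
    all [D i] have the same order. *)
Lemma rescale_D (i : 'I_N) : D i = rescale (z ^+ i) (D ord0).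
Proof.
suff h (k : nat) : f^`().[r k] = rescale (z ^+ k) f^`().[r 0%N].
  by rewrite !D_deriv h.
elim: k => [|k IH]; first by rewrite !expr0 !rescale1.
rewrite -rescale_r -{1}rescale_f deriv_map horner_map /= IH rescaleM.
by rewrite exprSr.
Qed.

Lemma leadD0 : exists2 d, d != 0 & lead kap d (D ord0).
Proof.
have h (i : 'I_N) : exists c, i != ord0 ->
    c != 0 /\ lead (lam i) c (yj - rescale (z ^+ i) yj).
  have [->|i0] := eqVneq i ord0; first by exists 0.
  have [|c c0 hc] := @contactj i; last by exists c => _; split.
  by rewrite ltn_ord andbT lt0n.
have [c hc] := fin_all_exists h.
exists (\prod_(i < N | i != ord0) c i).
  by apply/prodf_neq0 => i /hc [].
by apply: lead_prod => i /hc [_]; rewrite expr0 rescale1.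
Qed.

Lemma D_lead : exists2 d, d != 0 & forall i : 'I_N, lead kap ((z ^+ i) ^+ kap * d) (D i).
Proof.
have [d d0 hd] := leadD0; exists d => // i.
by rewrite rescale_D; apply: lead_rescale.
Qed.

Lemma z_neq0 : z != 0.
Proof.
have /eqP := prim_expr_order zprim; apply: contraTneq => ->.
by rewrite expr0n gtn_eqF ?n_gt0 // eq_sym oner_eq0.
Qed.

Lemma D_neq0 i : D i != 0.
Proof.
have [d d0 /(_ i) /lead_neq0] := D_lead; apply.
by rewrite mulf_neq0 // expf_neq0 // expf_neq0 // z_neq0.
Qed.

Lemma r_inj (i k : 'I_N) : r i = r k -> i = k.
Proof.
move=> rik; apply/eqP; apply: contraT => ik; case/eqP: (D_neq0 i).
by rewrite /D (bigD1 k) 1?eq_sym //= rik subrr mul0r.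
Qed.

Lemma PiE i : Pi = D i * M i.
Proof. by rewrite /Pi (bigD1 i). Qed.

Lemma f_monic : f \is monic.
Proof. by apply: monic_prod => i _; apply: monicXsubC. Qed.

Lemma size_f : size f = N.+1.
Proof. by rewrite /f -(big_enum _ _ 'I_N) size_prod_XsubC size_enum_ord. Qed.

Lemma l_monic i : l i \is monic.
Proof. by apply: monic_prod => k _; apply: monicXsubC. Qed.

Lemma size_l i : size (l i) = N.
Proof.
have := size_f; rewrite (fE i) size_monicM ?monicXsubC ?monic_neq0 ?l_monic //.
by rewrite size_XsubC /= => -[].
Qed.

(** Both sides have degree less than [N] in y and agree at the [N] distinct points [r k]. *)
Lemma lagrange (P : {poly {poly F}}) : (size P <= N)%N ->
  Pi%:P * P = \sum_(i < N) (M i * P.[r i])%:P * l i.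
Proof.
move=> sP; apply/eqP; rewrite -subr_eq0; apply/eqP.
apply: (@roots_geq_poly_eq0 _ _ [seq r (val i) | i <- enum 'I_N]).
- apply/allP => _ /mapP[k _ ->]; rewrite rootE hornerD hornerN hornerM hornerC.
  rewrite horner_sum (bigD1 k) //= [X in _ - (_ + X)]big1 => [|i ik].
    by rewrite hornerM hornerC l_diag addr0 (PiE k) subr_eq0; apply/eqP; ring.
  by rewrite hornerM l_root // mulr0.
- by rewrite map_inj_uniq ?enum_uniq // => i k; apply: r_inj.
rewrite size_map size_enum_ord; apply: leq_trans (size_polyD _ _) _.
rewrite geq_max size_polyN; apply/andP; split.
  by rewrite mul_polyC (leq_trans (size_scale_leq _ _)).
apply: leq_trans (size_sum _ _ _) _; apply/bigmax_leqP => i _.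
by rewrite mul_polyC (leq_trans (size_scale_leq _ _)) ?size_l.
Qed.

Lemma lagrange_coef (P : {poly {poly F}}) : (size P <= N)%N ->
  Pi * P`_N' = \sum_(i < N) M i * P.[r i].
Proof.
move=> /lagrange /(congr1 (fun Q : {poly {poly F}} => Q`_N')).
rewrite coefCM => ->; rewrite coef_sum; apply: eq_bigr => i _.
rewrite coefCM; have /monicP := l_monic i.
by rewrite /lead_coef size_l /= => ->; rewrite mulr1.
Qed.

Lemma horner_l i : (l i).[y] = L i.
Proof.
by rewrite /l horner_prod; apply: eq_bigr => k _; rewrite hornerXsubC.
Qed.

Lemma horner_f : f.[y] = \prod_(k < N) (y - r k).
Proof. by rewrite /f horner_prod; apply: eq_bigr => k _; rewrite hornerXsubC. Qed.

Lemma size_map_ev A : (size A <= N)%N -> (size (map_poly (comp_poly 'X^n) A) <= N)%N.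
Proof. by move=> h; apply: leq_trans (size_poly _ _) h. Qed.

Lemma lagrange_ev A : (size A <= N)%N ->
  Pi * ev y A = \sum_(i < N) M i * ev (r i) A * L i.
Proof.
move=> /size_map_ev /lagrange /(congr1 (horner^~ y)).
rewrite hornerM hornerC => ->; rewrite horner_sum; apply: eq_bigr => i _.
by rewrite hornerM hornerC horner_l.
Qed.

Lemma ev_e A : inXe e (ev yj A).
Proof.
rewrite /ev horner_coef; elim/big_rec: _ => [|i p _ hp]; first exact: inXe0.
apply: inXeD => //; apply: inXeM.
  rewrite coef_map /=; apply: inXe_compXn; first exact: n_gt0.
  by rewrite nE dvdn_mulr.
by elim: (nat_of_ord i) => [|k IH]; rewrite ?expr0 ?exprS;
  [apply: inXe1 | apply: inXeM].
Qed.

Lemma rescale_compXn (k : nat) (p : {poly F}) : rescale (z ^+ k) (p \Po 'X^n) = p \Po 'X^n.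
Proof.
apply: (@inXe_rescale _ n); first exact: inXe_compXn n_gt0 (dvdnn n).
by rewrite exprAC (prim_expr_order zprim) expr1n.
Qed.

Lemma rescale_ev (k : nat) A : rescale (z ^+ k) (ev yj A) = ev (r k) A.
Proof.
rewrite /ev -horner_map /= -map_poly_comp; congr (_.[_]).
by apply: eq_map_poly => p /=; rewrite rescale_compXn.
Qed.

(** * Leading terms of a form along the branch and along its truncation *)

Local Notation W := (form_at yj).

Lemma rescale_W (k : nat) A B : rescale (z ^+ k) (W A B) = form_at (r k) A B.
Proof.
rewrite /form_at rmorphD (rmorphM _ (ev yj A)) (rmorphM _ (ev yj B)) /=.
rewrite !rescale_ev rescale_theta.
congr (_ * _ + _); rewrite rmorphMn /=; congr (_ *+ n).
by have := rescale_compXn k 'X; rewrite comp_polyX.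
Qed.

(** Interpolate [A] and [B], then split [theta y] as [theta (r i) + theta (y - r i)]: the first part
    rebuilds the form at the conjugates, the second is a correction in [B] alone. *)
Lemma form_lagrange A B : (size A <= N)%N -> (size B <= N)%N ->
  Pi * form_at y A B = \sum_(i < N) M i * L i * form_at (r i) A B
     + \sum_(i < N) M i * ev (r i) B * (L i * theta (y - r i)).
Proof.
move=> sA sB; rewrite /form_at mulrDr !mulrA !lagrange_ev // -big_split /=.
rewrite !mulr_suml -big_split /=; apply: eq_bigr => i _.
by rewrite thetaB /theta; move: ('X^n *+ n) => ?; ring.
Qed.

(** The leading coefficient of [D i] carries [(z ^+ i) ^+ kap], so that of [Pi / D i] carries the
    inverse. *)
Lemma M_lead : exists2 m, m != 0 & forall i : 'I_N,
  lead (N' * kap) (m * (z ^+ i) ^- kap) (M i).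
Proof.
have [d d0 hd] := D_lead.
pose g (i : 'I_N) := (z ^+ i) ^+ kap * d.
have g0 i : g i != 0 by rewrite mulf_neq0 // !expf_neq0 // z_neq0.
exists ((\prod_i g i) / d) => [|i].
  by rewrite mulf_neq0 ?invr_eq0 //; apply/prodf_neq0.
have := lead_prod (fun k (_ : k != i) => hd k).
rewrite sum_nat_const cardC1 card_ord /=; congr (lead _ _ _).
have zi : (z ^+ i) ^+ kap != 0 by rewrite !expf_neq0 // z_neq0.
rewrite [in RHS](bigD1 i) //=; set Q := \prod_(k < N | k != i) _.
rewrite -/Q [g i]/g; move: zi; move: (_ ^+ kap) Q => u Q u0.
by field; rewrite ?d0 ?u0.
Qed.

Lemma Pi_lead : exists2 p, p != 0 & lead (N * kap) p Pi.
Proof.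
have [d d0 hd] := D_lead; exists (\prod_(i < N) ((z ^+ i) ^+ kap * d)).
  apply/prodf_neq0 => i _; by rewrite mulf_neq0 // !expf_neq0 // z_neq0.
by have := lead_prod (fun k (_ : true) => hd k); rewrite sum_nat_const card_ord.
Qed.

Lemma contact_fun : exists c : 'I_N -> F, forall i,
  c i != 0 /\ lead (lam i) (c i) (y - r i).
Proof.
apply: (@fin_all_exists 'I_N (fun=> F) (fun i c => c != 0 /\ lead (lam (i : nat)) c (y - r i))) => i.
by have [c] := contact (ltn_ord i); exists c.
Qed.

Lemma L_vge (i : 'I_N) : vge (b - lam i) (L i).
Proof.
have [c hc] := contact_fun.
have [] := lead_prod (fun k (_ : k != i) => (hc k).2).
suff -> : (b - lam i = \sum_(k < N | k != i) lam k)%N by [].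
by rewrite /b (bigD1 i) //= addKn.
Qed.

Lemma L0_lead : exists2 c, c != 0 & lead kap c (L ord0).
Proof.
have [c hc] := contact_fun; exists (\prod_(k < N | k != ord0) c k).
  by apply/prodf_neq0 => k _; case: (hc k).
exact: lead_prod (fun k _ => (hc k).2).
Qed.

(** The product is [f] at [y] times the logarithmic derivative of [y - r i], which contributes the
    factor [lam i]. *)
Lemma Ltheta_lead : exists2 c, c != 0 & forall i : 'I_N,
  lead b (c * (lam i)%:R) (L i * theta (y - r i)).
Proof.
have [c hc] := contact_fun; exists (\prod_k c k).
  by apply/prodf_neq0 => k _; case: (hc k).
move=> i; have h1 := lead_prod (fun k (_ : k != i) => (hc k).2).
have := leadM h1 (lead_theta (hc i).2).
have -> : (b = \sum_(k < N | k != i) lam k + lam i)%N.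
  by rewrite /b (bigD1 i) //= addnC.
congr (lead _ _ _).
by rewrite [in RHS](bigD1 i) //= -mulr_natr; ring.
Qed.

(** In the first sum of [form_lagrange] only [i = 0] counts, because [L i] has order greater than
    [kap] for the other [i]. In the second sum all terms have the same lower bound on their order,
    and their coefficients form a character sum covered by [lam_pos]. *)
Lemma form_lead : exists c1, exists2 c2 : nat -> F,
  c1 != 0 /\ (forall q, (e %| q)%N -> c2 q != 0) &
  forall A B k, (size A <= N)%N -> (size B <= N)%N ->
    vge k (W A B) -> vge (k - beta) (ev yj B) ->
    lead (N * kap + k)
      (c1 * (W A B)`_k +
       if (k < beta)%N then 0 else c2 (k - beta)%N * (ev yj B)`_(k - beta))
      (Pi * form_at y A B).
Proof.
have [m m0 hM] := M_lead; have [l0 l00 hL0] := L0_lead.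
have [c c0 hT] := Ltheta_lead.
(* The power [z ^+ q] comes from rescaling a term of order [q], and [z ^+ kap] from [M_lead]. For
   [e] dividing [q] their quotient is an N-th root of unity. *)
exists (m * l0); exists (fun q => c * m * \sum_(i < N) (z ^+ q / z ^+ kap) ^+ i * (lam i)%:R).
  split=> [|q eq]; first exact: mulf_neq0.
  rewrite mulf_neq0 ?mulf_neq0 //; apply: lam_pos.
  have h k : (e %| k)%N -> (z ^+ k) ^+ N = 1.
    case/dvdnP=> s ->; rewrite -exprM -mulnA -nE mulnC exprM.
    by rewrite (prim_expr_order zprim) expr1n.
  by rewrite expr_div_n !h ?kap_e // divr1.
move=> A B k sA sB hW hB; rewrite (form_lagrange sA sB).
apply: leadD.
  have -> : m * l0 * (W A B)`_k = \sum_(i < N) if i == ord0 then m * l0 * (W A B)`_k else 0.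
    by rewrite -big_mkcond big_pred1_eq.
  apply: lead_sum => i _; rewrite -rescale_W.
  have [->|i0] := eqVneq i ord0.
    have := leadM (leadM (hM ord0) hL0) (lead_rescale (z ^+ 0%N) (vge_lead hW)).
    by rewrite !expr0 !expr1n invr1 mulr1 mul1r mulSn addnC [(kap + _)%N]addnC addnC.
  apply: (@vge_lead0 _ _ (N' * kap + (b - lam i) + k)); last first.
    apply: vgeM; last exact: vge_rescale.
    apply: vgeM; last exact: L_vge.
    by case: (hM i).
  rewrite ltn_add2r mulSn addnC ltn_add2l bE.
  have : (lam i < beta)%N by rewrite lam_lt // ltn_ord lt0n andbT.
  by clearbody b kap; clear; lia.
have hBi (i : 'I_N) : lead (k - beta) ((z ^+ i) ^+ (k - beta) * (ev yj B)`_(k - beta)) (ev (r i) B).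
  by rewrite -rescale_ev; apply: lead_rescale.
have h (i : 'I_N) := leadM (leadM (hM i) (hBi i)) (hT i).
(* For [k < beta] the truncated difference [k - beta] is 0, and the second sum starts beyond the
   order considered because [b = beta + kap]. *)
case: ltnP => kb.
  apply: (@vge_lead0 _ _ (N' * kap + (k - beta) + b)); last first.
    by apply: vge_sum => i _; case: (h i).
  by move: kb; rewrite bE mulSn; clearbody b kap; clear; lia.
have -> : (N * kap + k = N' * kap + (k - beta) + b)%N.
  by move: kb; rewrite bE mulSn; clearbody b kap; clear; lia.
have := lead_sum (fun i (_ : true) => h i).
congr (lead _ _ _); rewrite mulr_sumr mulr_suml; apply: eq_bigr => i _.
rewrite expr_div_n -!exprM ![(_ * i)%N]mulnC; ring.
Qed.

Lemma W_e A B : inXe e (W A B).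
Proof.
apply: inXeD; apply: inXeM; try exact: ev_e; last exact: inXe_theta.
move=> k; rewrite coefMn coefXn; have [->|_] := eqVneq k n.
  by rewrite nE dvdn_mulr.
by rewrite mul0rn eqxx.
Qed.

(** The two contributions in [form_lead] cannot cancel: one lives in exponents divisible by [e], the
    other in exponents congruent to [beta] modulo [e]. *)
Lemma form_coef_key A B k : (size A <= N)%N -> (size B <= N)%N ->
  vge k (form_at y A B) -> vge k (W A B) -> vge (k - beta) (ev yj B) ->
  if (form_at y A B)`_k == 0 then (W A B)`_k = 0 /\ vge (k.+1 - beta) (ev yj B)
  else if (e %| k)%N then (W A B)`_k != 0 /\ vge (k.+1 - beta) (ev yj B)
  else [/\ (W A B)`_k = 0, (beta <= k)%N, (e %| k - beta)%N
         & (ev yj B)`_(k - beta) != 0].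
Proof.
move=> sA sB hk hW hB; have [c1 [c2 [c10 c20] h]] := form_lead.
have {h} [_ h] := h A B k sA sB hW hB.
have [p p0 hp] := Pi_lead.
move: (leadM hp (vge_lead hk)) => [_]; rewrite {}h => h.
have hW0 : ~~ (e %| k)%N -> (W A B)`_k = 0.
  by move=> ek; apply/eqP; apply: contraR ek => /W_e.
have hvge : ((beta <= k)%N -> (ev yj B)`_(k - beta) = 0) -> vge (k.+1 - beta) (ev yj B).
  case: leqP => kb h'; last by rewrite (eqP (kb : (k.+1 - beta == 0)%N)).
  by rewrite subSn //; apply: vgeSr => //; apply: h'.
have [ek|ek] := boolP (e %| k)%N.
  have hB0 : (beta <= k)%N -> (ev yj B)`_(k - beta) = 0.
    move=> kb; apply/eqP; apply: contraNT beta_e => /ev_e ekb.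
    by rewrite -(subKn kb) dvdn_sub.
  have {}h : c1 * (W A B)`_k = p * (form_at y A B)`_k.
    rewrite -h; case: ltnP => kb; first by rewrite addr0.
    by rewrite hB0 // mulr0 addr0.
  have [f0|f0] := eqVneq; split; try exact: hvge.
    by move: h; rewrite f0 mulr0 => /eqP; rewrite mulf_eq0 (negPf c10) => /eqP.
  by apply: contraNneq (mulf_neq0 p0 f0) => W0; rewrite -h W0 mulr0.
have hW1 := hW0 ek; move: h; rewrite hW1 mulr0 add0r.
have [f0|f0] := eqVneq => h.
  split=> //; apply: hvge => kb; move: h; rewrite ltnNge kb f0 mulr0 => h.
  apply/eqP; apply: contraT => B0; move/eqP: h; rewrite mulf_eq0 (negPf B0) orbF.
  by rewrite (negPf (c20 _ (ev_e B0))).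
case: ltnP h => kb h; first by have := mulf_neq0 p0 f0; rewrite -h eqxx.
have B0 : (ev yj B)`_(k - beta) != 0.
  by apply: contraNneq (mulf_neq0 p0 f0) => B0; rewrite -h B0 mulr0.
by split=> //; apply: ev_e B0.
Qed.

Lemma form_vge A B k : (size A <= N)%N -> (size B <= N)%N ->
  vge k (form_at y A B) -> vge k (W A B) /\ vge (k - beta) (ev yj B).
Proof.
move=> sA sB; elim: k => [|k IH] hk; first by rewrite sub0n.
have hk' : vge k (form_at y A B) by apply: vge_le hk.
have [hW hB] := IH hk'; have := form_coef_key sA sB hk' hW hB.
rewrite hk // eqxx => -[W0 hB']; split=> //; exact: vgeSr.
Qed.

Lemma form_val A B k : (size A <= N)%N -> (size B <= N)%N ->
  vge k (form_at y A B) -> (form_at y A B)`_k != 0 ->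
  if (e %| k)%N then [/\ vge k (W A B), (W A B)`_k != 0 & vge (k.+1 - beta) (ev yj B)]
  else [/\ vge k.+1 (W A B), vge (k - beta) (ev yj B), (beta <= k)%N, (e %| k - beta)%N
         & (ev yj B)`_(k - beta) != 0].
Proof.
move=> sA sB hk hf; have [hW hB] := form_vge sA sB hk.
have := form_coef_key sA sB hk hW hB; rewrite (negPf hf).
by case: ifP => _ []; split=> //; apply: vgeSr.
Qed.

(** * The pairing of two forms through their wedge product modulo [f] *)

Definition det2 A B A' B' := A * B' - A' * B.

(** Here [T] is the coefficient of y^N' in the remainder of [det2] modulo [f]. Apply
    [lagrange_coef], and eliminate [A] and [A'] at each conjugate in favour of the pulled back
    forms, at the cost of the factor n t^n. *)
Lemma pairing A B A' B' : exists T : {poly F},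
  T`_0 = ((det2 A B A' B')`_N')`_0 /\
  Pi * T * ('X^n *+ n) = \sum_(i < N) M i *
     (rescale (z ^+ i) (W A B) * rescale (z ^+ i) (ev yj B')
      - rescale (z ^+ i) (W A' B') * rescale (z ^+ i) (ev yj B)).
Proof.
set H := det2 A B A' B'; pose Ht := map_poly (comp_poly 'X^n) H.
pose T := Pdiv.Ring.rmodp Ht f; have HtE := Pdiv.RingMonic.rdivp_eq f_monic Ht.
have sT : (size T <= N)%N.
  by rewrite -ltnS -size_f Pdiv.Ring.ltn_rmodpN0 // monic_neq0 // f_monic.
exists T`_N'; split.
  (* At t = 0 all conjugates vanish and [f] becomes y^N, so reduction modulo [f] does not change the
     coefficient of y^N' there. *)
  have := congr1 (fun p : {poly {poly F}} => (map_poly (horner_eval 0) p)`_N') HtE.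
  rewrite rmorphD rmorphM /= coefD.
  have -> : map_poly (horner_eval 0) f = 'X^N.
    rewrite /f rmorph_prod /= -[N in 'X^N](card_ord N) -prodr_const.
    apply: eq_bigr => i _; rewrite rmorphB /= map_polyX map_polyC /=.
    by rewrite /horner_eval horner_coef0 coef_rescale yj0 mulr0 subr0.
  rewrite coefMXn ltnSn add0r !coef_map /= /horner_eval !horner_coef0.
  by move=> <-; rewrite coef_comp_poly_Xn ?n_gt0 // dvdn0 div0n.
rewrite (lagrange_coef sT) mulr_suml; apply: eq_bigr => i _.
have -> : T.[r i] = ev (r i) A * ev (r i) B' - ev (r i) A' * ev (r i) B.
  have := congr1 (horner^~ (r i)) HtE; rewrite hornerD hornerM.
  rewrite [in f.[_]](fE i) hornerM hornerXsubC subrr mul0r mulr0 add0r => <-.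
  by rewrite /Ht rmorphB !rmorphM /= hornerD hornerN !hornerM.
rewrite !rescale_W !rescale_ev /form_at /theta; move: ('X^n *+ n) => ?; ring.
Qed.

(** The sum in [pairing] has order at least [N' * kap + v + v' - beta]. Removing [Pi] and t^n leaves
    [T] with positive order. *)
Lemma det2_eq0 A B A' B' v v' : (size A <= N)%N -> (size B <= N)%N ->
  (size A' <= N)%N -> (size B' <= N)%N ->
  vge v (form_at y A B) -> vge v' (form_at y A' B') -> (b + n < v + v')%N ->
  ((det2 A B A' B')`_N')`_0 = 0.
Proof.
move=> sA sB sA' sB' /(form_vge sA sB)[hW hB] /(form_vge sA' sB')[hW' hB'] hv.
have [T [<- hT]] := pairing A B A' B'.
have [m m0 hM] := M_lead; have [p p0 hp] := Pi_lead.
have : vge (N * kap + n.+1) (Pi * (T * ('X^n *+ n))).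
  rewrite mulrA hT; apply: vge_sum => i _.
  apply: (@vge_le _ _ (N' * kap + (v + v' - beta))).
    by move: hv; rewrite bE mulSn; clearbody b kap; clear; lia.
  apply: vgeM; first by case: (hM i).
  apply: vgeB.
    apply: (@vge_le _ _ (v + (v' - beta))); first by clearbody b kap; clear; lia.
    by apply: vgeM; apply: vge_rescale.
  apply: (@vge_le _ _ (v' + (v - beta))); first by clearbody b kap; clear; lia.
  by apply: vgeM; apply: vge_rescale.
move=> /(vge_cancel hp p0) /(_ n (ltnSn n)).
rewrite mulrnAr coefMn coefMXn ltnn subnn => /eqP.
by rewrite mulrn_eq0 eqn0Ngt n_gt0 => /eqP.
Qed.

Definition value v := exists A B, [/\ (size A <= N)%N, (size B <= N)%N,
  vge v (form_at y A B) & (form_at y A B)`_v != 0].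

Lemma value_dvd_or v : value v -> (e %| v)%N \/ (beta <= v)%N /\ (e %| v - beta)%N.
Proof.
case=> A [B [sA sB hv v0]]; have := form_val sA sB hv v0.
by case: ifP => [_ _|_ []]; [left | right].
Qed.

(** If [v + v' = b], the [N] conjugate terms in [pairing] share one nonzero coefficient at order
    [N * kap]. Their sum is then nonzero there, against the factor t^n on the other side. *)
Lemma value_dual_aux v v' : (e %| v)%N -> value v -> value v' -> (v + v' != b)%N.
Proof.
move=> dv [A [B [sA sB hv v0]]] [A' [B' [sA' sB' hv' v'0]]].
apply/eqP => vb; have ev' : (e %| v')%N = false.
  apply/negP => ev'; case/negP: beta_e.
  by rewrite -(dvdn_addl _ kap_e) -bE -vb dvdn_add.
have := form_val sA sB hv v0; rewrite dv => -[hW W0 hB].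
have := form_val sA' sB' hv' v'0; rewrite ev' => -[hW' hB' bv' ev'b B'0].
have [T [_ hT]] := pairing A B A' B'.
have [m m0 hM] := M_lead; have [p p0 hp] := Pi_lead.
have kE : (v + (v' - beta) = kap)%N by move: vb bv'; rewrite bE; clearbody b kap; clear; lia.
have h1 (i : 'I_N) := lead_rescale (z ^+ i) (vge_lead hW).
have h2 (i : 'I_N) := lead_rescale (z ^+ i) (vge_lead hB').
have h3 (i : 'I_N) := vge_rescale (z ^+ i) hW'.
have h4 (i : 'I_N) := vge_rescale (z ^+ i) hB.
have h5 (i : 'I_N) : lead kap 0 (rescale (z ^+ i) (W A' B') * rescale (z ^+ i) (ev yj B)).
  apply: vge_lead0 (vgeM (h3 i) (h4 i)); move: vb; rewrite bE; clearbody b kap; clear; lia.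
have h6 (i : 'I_N) := leadM (h1 i) (h2 i); rewrite kE in h6.
have h7 (i : 'I_N) := leadM (hM i) (leadB (h6 i) (h5 i)).
have := lead_sum (fun i (_ : true) => h7 i).
rewrite -hT -mulrA => -[_]; have [hp' _] := hp.
have h8 : vge n (T * ('X^n *+ n)).
  by move=> k kn; rewrite mulrnAr coefMn coefMXn kn mul0rn.
rewrite (vgeM hp' h8); last by rewrite mulSn addnC -{1}[(_ + _)%N]addn0 ltn_add2l n_gt0.
move=> /esym; apply/eqP.
(* The powers of [z ^+ i] cancel because [v + (v' - beta) = kap]. *)
under eq_bigr => i _.
  have -> : m * (z ^+ i) ^- kap * ((z ^+ i) ^+ v * (W A B)`_v *
     ((z ^+ i) ^+ (v' - beta) * (ev yj B')`_(v' - beta)) - 0) =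
     m * (W A B)`_v * (ev yj B')`_(v' - beta).
    have zi : (z ^+ i) ^+ kap != 0 by rewrite !expf_neq0 // z_neq0.
    rewrite subr0 [X in _ * X](_ : _ = (z ^+ i) ^+ kap * ((W A B)`_v * (ev yj B')`_(v' - beta))).
      by rewrite !mulrA mulfVK.
    by rewrite -kE exprD; ring.
  over.
by rewrite sumr_const card_ord mulrn_eq0 /= !mulf_neq0.
Qed.

(** If [e] divides neither value, it divides [v - beta]; as it divides [kap], the equality
    [v + v' = b] would make it divide [v']. *)
Lemma value_dual v v' : value v -> value v' -> (v + v' != b)%N.
Proof.
move=> hv hv'; have [ev|nev] := boolP (e %| v)%N; first exact: value_dual_aux.
have [ev'|nev'] := boolP (e %| v')%N; first by rewrite addnC; apply: value_dual_aux.
apply/eqP => vb; have [|[bv dv]] := value_dvd_or hv; first by rewrite (negPf nev).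
case/negP: nev'; rewrite -(dvdn_addr _ dv).
have -> : (v - beta + v' = kap)%N by move: vb bv; rewrite bE; clearbody b kap; clear; lia.
exact: kap_e.
Qed.

(** * Residue classes of values and the Gram determinant *)

Lemma ev_scale x (p : {poly F}) A : ev x (p *: A) = (p \Po 'X^n) * ev x A.
Proof. by rewrite /ev -mul_polyC rmorphM /= map_polyC hornerM hornerC. Qed.

Lemma evB x A A' : ev x (A - A') = ev x A - ev x A'.
Proof. by rewrite /ev rmorphB /= hornerD hornerN. Qed.

Lemma form_scale x (p : {poly F}) A B :
  form_at x (p *: A) (p *: B) = (p \Po 'X^n) * form_at x A B.
Proof. by rewrite /form_at !ev_scale mulrDr !mulrA. Qed.

Lemma formB x A B A' B' :
  form_at x (A - A') (B - B') = form_at x A B - form_at x A' B'.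
Proof. by rewrite /form_at !evB; move: ('X^n *+ n) => ?; rewrite /theta; ring. Qed.

Lemma value_shift v q : value v -> value (v + n * q)%N.
Proof.
case=> A [B [sA sB hv v0]]; exists ('X^q *: A), ('X^q *: B).
rewrite form_scale comp_Xn_poly -exprM addnC; split.
- exact: leq_trans (size_scale_leq _ _) sA.
- exact: leq_trans (size_scale_leq _ _) sB.
- by apply: vgeM => //; case: (leadXn F (n * q)).
by rewrite coefXnM ltnNge leq_addr addKn.
Qed.

(** The [2N] residues modulo [n] available to a value. They are indexed so that the left and right
    classes of the same [i] add up to [b] modulo [n], as duality requires. *)
Definition class (r : 'I_(N + N)) v : bool :=
  match split r with
  | inl i => (v == e * i %[mod n])%N
  | inr i => (v + e * i == b %[mod n])%N
  end.

Lemma value_class v : value v -> exists r, class r v.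
Proof.
case/value_dvd_or=> [/dvdnP[q ->]|[bv /dvdnP[q qE]]].
  have lt : (q %% N < N)%N by rewrite ltn_mod.
  exists (lshift N (Ordinal lt)); rewrite /class (unsplitK (inl _)) /=.
  by rewrite muln_modr -nE modn_mod mulnC.
have [k kE] := dvdnP kap_e.
(* The index is [k - q] modulo [N], with [N'] in the role of -1. *)
have lt : ((k + N' * q) %% N < N)%N by rewrite ltn_mod.
exists (rshift N (Ordinal lt)); rewrite /class (unsplitK (inr _)) /=.
rewrite muln_modr -nE modnDmr; apply/eqP.
rewrite bE kE -(subnK bv) qE -(modnMDl q (beta + k * e)); congr (_ %% _)%N.
by rewrite nE /N mulnS; ring.
Qed.

Lemma class_mod r v v' : (v <= v')%N -> class r v -> class r v' -> (n %| v' - v)%N.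
Proof.
move=> vv'; rewrite /class -eqn_mod_dvd //; case: split => i /eqP h /eqP h'.
  by rewrite h h'.
by rewrite -(eqn_modDr (e * i)) h h'.
Qed.

(** The image of a form in the fibre at x = 0 of the module of forms of degree less than [N] in
    y. *)
Definition at0 A B : 'rV[F]_(N + N) :=
  row_mx (\row_(i < N) (A`_i)`_0) (\row_(i < N) (B`_i)`_0).

Lemma at0_surj (w : 'rV[F]_(N + N)) : exists A B,
  [/\ (size A <= N)%N, (size B <= N)%N & w = at0 A B].
Proof.
exists (\poly_(i < N) (lsubmx w 0 (inord i))%:P), (\poly_(i < N) (rsubmx w 0 (inord i))%:P).
split; rewrite ?size_poly //; rewrite -[LHS]hsubmxK /at0; congr row_mx;
  apply/rowP=> i; by rewrite !mxE coef_poly ltn_ord coefC /= inord_val !mxE.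
Qed.

Lemma at0_scaleB A B A' B' c q :
  at0 (A - (c *: 'X^q) *: A') (B - (c *: 'X^q) *: B')
  = at0 A B - (c *+ (q == 0%N)) *: at0 A' B'.
Proof.
rewrite /at0 scale_row_mx opp_row_mx add_row_mx; congr row_mx; apply/rowP=> i;
  rewrite !mxE coefB coefB coefZ coef0M coefZ coefXn eq_sym;
  by rewrite -[c *+ _]mulr_natr.
Qed.

(** The pairing reads off the coefficient of y^N', so y^i is matched with y^(N' - i). This makes [J]
    antidiagonal and [sympl] the Gram matrix on the fibre. *)
Let J : 'M[F]_N := \matrix_(i, k) (i == rev_ord k)%:R.
Definition sympl : 'M[F]_(N + N) := block_mx 0 J (- J) 0.

Lemma mul_J m (a : 'M[F]_(m, N)) i k : (a *m J) i k = a i (rev_ord k).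
Proof.
rewrite mxE (bigD1 (rev_ord k)) //= mxE eqxx mulr1 big1 ?addr0 // => j jk.
by rewrite mxE (negPf jk) mulr0.
Qed.

Lemma sympl_unit : sympl \in unitmx.
Proof.
have JJ : J *m J = 1%:M.
  by apply/matrixP=> i k; rewrite mul_J !mxE rev_ordK.
have : sympl *m (- sympl) = 1%:M.
  rewrite /sympl opp_block_mx mulmx_block !oppr0 !(mulmx0, mul0mx) opprK !add0r !addr0.
  by rewrite !(mulmxN, mulNmx) JJ opprK -scalar_mx_block.
by case/mulmx1_unit.
Qed.

Lemma sympl_coef A B A' B' :
  (at0 A B *m sympl *m (at0 A' B')^T) 0 0 = ((det2 A B A' B')`_N')`_0.
Proof.
have h P P' : ((\row_(i < N) (P`_i)`_0) *m J *m (\row_(i < N) (P'`_i)`_0)^T) 0 0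
   = ((P * P')`_N')`_0.
  rewrite mxE coefM coef_sum (reindex_inj rev_ord_inj); apply: eq_bigr => i _.
  by rewrite mul_J rev_ordK !mxE coef0M /= subSS.
rewrite /at0 /sympl mul_row_block !mulmx0 add0r addr0 tr_row_mx mul_row_col.
rewrite mulmxN mulNmx !mxE.
have := h A B'; have := h B A'; rewrite !mxE => -> ->.
by rewrite /det2 !coefB addrC [B * A']mulrC.
Qed.

Lemma size_sub_scale A A' (p : {poly F}) :
  (size A <= N)%N -> (size A' <= N)%N -> (size (A - p *: A')%R <= N)%N.
Proof.
move=> sA sA'; apply: leq_trans (size_polyD _ _) _.
by rewrite geq_max sA size_polyN (leq_trans (size_scale_leq _ _)).
Qed.

(** By [det2_eq0] with [v' = 0] such a form is orthogonal to every form, and the pairing on the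
    fibre is nondegenerate. *)
Lemma at0_eq0 A B : (size A <= N)%N -> (size B <= N)%N ->
  vge (b + n).+1 (form_at y A B) -> at0 A B = 0.
Proof.
move=> sA sB hv; have h (w : 'rV_(N + N)) : (at0 A B *m sympl *m w^T) 0 0 = 0.
  have [A' [B' [sA' sB' ->]]] := at0_surj w; rewrite sympl_coef.
  by apply: (@det2_eq0 _ _ _ _ (b + n).+1 0) => //; rewrite addn0.
have : at0 A B *m sympl = 0.
  apply/rowP=> i; rewrite [RHS]mxE -(h (delta_mx 0 i)) trmx_delta.
  by rewrite -colE [RHS]mxE.
by move/(canRL (mulmxK sympl_unit)); rewrite mul0mx.
Qed.

(** Take a form of least value in each class. Their images span the fibre, so their Gram determinant
    is nonzero. One nonzero term of its expansion provides [s], and [det2_eq0] bounds the sums of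
    values. *)
Lemma minimal_values : exists v : 'I_(N + N) -> nat,
  [/\ forall r, value (v r) /\ class r (v r),
      forall r v', value v' -> class r v' -> (v r <= v')%N
    & exists s : 'S_(N + N), forall r, (v r + v (s r) <= b + n)%N].
Proof.
pose att r (d : nat * ({poly {poly F}} * {poly {poly F}})) :=
  [/\ vge d.1 (form_at y d.2.1 d.2.2), (form_at y d.2.1 d.2.2)`_d.1 != 0,
      class r d.1 & forall v', value v' -> class r v' -> (d.1 <= v')%N].
pose P r (d : nat * ({poly {poly F}} * {poly {poly F}})) :=
  [/\ (size d.2.1 <= N)%N, (size d.2.2 <= N)%N &
   att r d \/ at0 d.2.1 d.2.2 = 0 /\ forall v', value v' -> ~~ class r v'].
have /fin_all_exists[d hd] r : exists d, P r d.
  have [[v0 [hv0 cv0]]|no] := EM (exists v, value v /\ class r v).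
    have ex : exists v, `[< value v /\ class r v >] by exists v0; apply/asboolP.
    case: (ex_minnP ex) => v /asboolP[[A [B [sA sB hv vn0]]] cv] vmin.
    exists (v, (A, B)); split=> //; left; split=> // v' hv' cv'.
    by apply: vmin; apply/asboolP.
  (* A class without values provisionally receives the zero form; the invertibility of [G] later
     excludes this case. *)
  exists (0%N, (0, 0)); split; rewrite ?size_poly0 //; right; split.
    by apply/rowP=> i; rewrite /at0 mxE; case: split => j; rewrite !mxE !coef0.
  by move=> v' hv'; apply/negP => cv'; apply: no; exists v'.
pose u r := at0 (d r).2.1 (d r).2.2; pose G := \matrix_r u r.
(* Induction on the orders left up to [b + n]: subtracting a multiple of the chosen form of the same
   class raises the order, and beyond [b + n] the image in the fibre is zero. *)
have span A B m k : (b + n < k + m)%N -> (size A <= N)%N -> (size B <= N)%N ->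
    vge k (form_at y A B) -> (at0 A B <= G)%MS.
  elim: m A B k => [|m IH] A B k km sA sB hk.
    by rewrite (at0_eq0 sA sB) ?sub0mx //; apply: vge_le hk; rewrite -[k]addn0.
  have [k0|k0] := eqVneq (form_at y A B)`_k 0.
    by apply: (IH A B k.+1) => //; [rewrite addSnnS | apply: vgeSr].
  have vk : value k by exists A, B.
  have [r cr] := value_class vk; have [sAr sBr] := hd r.
  case=> [[hr r0 cdr dmin]|[_ /(_ _ vk)]]; last by rewrite cr.
  have dk := dmin _ vk cr; have /dvdnP[q qE] := class_mod dk cdr cr.
  pose c := (form_at y A B)`_k / (form_at y (d r).2.1 (d r).2.2)`_(d r).1.
  have := IH (A - (c *: 'X^q) *: (d r).2.1) (B - (c *: 'X^q) *: (d r).2.2) k.+1.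
  rewrite addSnnS at0_scaleB formB form_scale => /(_ km) h.
  have /h{h} : vge k.+1 (form_at y A B - (c *: 'X^q \Po 'X^n) * form_at y (d r).2.1 (d r).2.2).
    have kE : (k = n * q + (d r).1)%N by rewrite mulnC -qE subnK.
    rewrite comp_polyZ comp_Xn_poly -exprM -scalerAl.
    have hl := leadM (leadXn F (n * q)) (vge_lead hr); rewrite -kE mul1r in hl.
    apply: vgeSr.
      by apply: vgeB => // i ik; rewrite coefZ (hl.1 _ ik) mulr0.
    by rewrite coefB coefZ hl.2 /c divfK ?subrr.
  rewrite !size_sub_scale // => /(_ isT isT) hs.
  rewrite -(subrK ((c *+ (q == 0%N)) *: u r) (at0 A B)).
  apply: addmx_sub => //; apply: scalemx_sub.
  by rewrite -(rowK u r) row_sub.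
have G1 : G \in unitmx.
  rewrite -row_full_unit -sub1mx; apply/row_subP => i.
  have [A [B [sA sB ->]]] := at0_surj (row i 1%:M).
  by apply: (span A B (b + n).+1 0%N) => //; rewrite add0n.
have hatt r : att r (d r).
  have [_ _ [//|[ur0 _]]] := hd r; exfalso.
  have : row r G = 0 by rewrite rowK.
  rewrite rowE => /(canRL (mulmxK G1)); rewrite mul0mx => /rowP/(_ r).
  by rewrite !mxE !eqxx => /eqP; rewrite oner_eq0.
exists (fun r => (d r).1); split.
- move=> r; have [hr r0 cr _] := hatt r; split=> //.
  by have [sA sB _] := hd r; exists (d r).2.1, (d r).2.2.
- by move=> r v'; have [_ _ _] := hatt r; apply.
have : G *m sympl *m G^T \in unitmx by rewrite !unitmx_mul G1 sympl_unit unitmx_tr G1.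
rewrite unitmxE unitfE => det0.
have /existsP[s hs] : [exists s : 'S_(N + N), \prod_r (G *m sympl *m G^T) r (s r) != 0].
  apply: contraR det0 => /existsPn no; rewrite /determinant big1 // => s _.
  by have := no s; rewrite negbK => /eqP ->; rewrite mulr0.
exists s => r; rewrite leqNgt; apply/negP => hlt.
have [sA sB _] := hd r; have [sA' sB' _] := hd (s r).
have [hr _ _ _] := hatt r; have [hr' _ _ _] := hatt (s r).
have := det2_eq0 sA sB sA' sB' hr hr' hlt; rewrite -sympl_coef => h.
move/prodf_neq0/(_ r isT)/eqP: hs; apply; rewrite -[RHS]h.
transitivity (row r (G *m sympl *m G^T) 0 (s r)); first by rewrite [RHS]mxE.
rewrite !row_mul rowK [LHS]mxE [RHS]mxE; apply: eq_bigr => k _.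
by congr (_ * _); rewrite !mxE.
Qed.

(** The least values of two matched classes add up to [b] modulo [n], and by [value_dual] to at
    least [b + n]. The total bound from [minimal_values] forces equality, so the gaps of one class
    mirror the values of the other. *)
Lemma value_codual v : (e %| v)%N -> (v <= b)%N -> ~ value v -> value (b - v).
Proof.
move=> dv vb nv; have [w [wval wmin [s hs]]] := minimal_values.
have nb (i : 'I_N) : (b + n <= w (lshift N i) + w (rshift N i))%N.
  rewrite leqNgt; apply/negP => lt.
  have [v1 c1] := wval (lshift N i); have [v2 c2] := wval (rshift N i).
  move: c1 c2; rewrite /class (unsplitK (inl _)) (unsplitK (inr _)) => /eqP c1 /eqP c2.
  have c : (b == w (lshift N i) + w (rshift N i) %[mod n])%N.
    by rewrite -c2 addnC -modnDml -c1 modnDml.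
  have le : (w (lshift N i) + w (rshift N i) <= b)%N.
    rewrite leqNgt; apply/negP => lt'; move: c; rewrite eq_sym eqn_mod_dvd 1?ltnW //.
    by move=> /dvdn_leq; move: lt lt'; clearbody b kap; clear; lia.
  move: c; rewrite eqn_mod_dvd // => /dvdnP[q qE].
  by case/eqP: (value_dual (value_shift q v1) v2); rewrite mulnC; move: le qE; clearbody b kap; clear; lia.
(* Summing [w r + w (s r)] over all [r] counts each least value twice. *)
have tot : (\sum_(i < N) (w (lshift N i) + w (rshift N i)) <= N * (b + n))%N.
  have -> : (\sum_(i < N) (w (lshift N i) + w (rshift N i)) = \sum_r w r)%N.
    by rewrite big_split_ord big_split.
  rewrite -(leq_pmul2l (ltn0Sn 1)) mul2n -addnn.
  rewrite [X in (_ + X)%N](reindex_inj (@perm_inj _ s)) -big_split /=.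
  apply: (@leq_trans (\sum_(r < N + N) (b + n))); first by apply: leq_sum => r _.
  by rewrite sum_nat_const card_ord mul2n -addnn mulnDl.
have eqb (i : 'I_N) : (w (lshift N i) + w (rshift N i) = b + n)%N.
  apply/eqP; rewrite eqn_leq nb andbT leqNgt; apply/negP => lt.
  move: tot; rewrite leqNgt => /negP; apply.
  rewrite -[X in (X * _)%N](card_ord N) -sum_nat_const.
  rewrite (bigD1 i) //= [X in (_ < X)%N](bigD1 i) //= -addSn leq_add //.
  exact: leq_sum.
have [q qE] := dvdnP dv.
have ltq : (q %% N < N)%N by rewrite ltn_mod.
pose i : 'I_N := Ordinal ltq.
have ci : class (lshift N i) v.
  by rewrite /class (unsplitK (inl _)) /= muln_modr -nE modn_mod qE mulnC.
have [v1 c1] := wval (lshift N i); have [v2 c2] := wval (rshift N i).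
have lt : (v < w (lshift N i))%N.
  rewrite ltnNge; apply/negP => le; apply: nv.
  have /dvdnP[p pE] := class_mod le c1 ci.
  by have := value_shift p v1; rewrite mulnC -pE subnKC.
have /dvdnP[p pE] := class_mod (ltnW lt) ci c1.
(* The least value of the left class is [v + p * n] with [p > 0], so by [eqb] the number [b - v]
   exceeds the least value of the right class by [p.-1 * n]. *)
have := value_shift p.-1 v2; rewrite mulnC.
have p0 : (0 < p)%N by case: p pE lt => //; clearbody b kap; clear; lia.
have -> : (w (rshift N i) + p.-1 * n = b - v)%N.
  by have := eqb i; case: p p0 pE lt => //= p _; rewrite mulSn; clearbody b kap; clear; lia.
by [].
Qed.

(** Invariance under [rescale z] makes the coefficients of [f] polynomials in t^n, so [f] comes from
    a polynomial in x and y. *)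
Lemma f_descent : exists g, [/\ g \is monic, size g = N.+1 & map_poly (comp_poly 'X^n) g = f].
Proof.
have fn k : inXe n f`_k.
  move=> i fi; rewrite (prim_order_dvd zprim).
  have := congr1 (fun p : {poly {poly F}} => p`_k`_i) rescale_f.
  rewrite coef_map /= coef_rescale => /eqP.
  by rewrite -[X in _ == X]mul1r (inj_eq (mulIf fi)).
pose g : {poly {poly F}} := \poly_(k < N.+1) \poly_(i < size f`_k) f`_k`_(i * n).
have gf : map_poly (comp_poly 'X^n) g = f.
  apply/polyP=> k; rewrite coef_map /= coef_poly; case: ltnP => kN; last first.
    by rewrite comp_poly0 nth_default ?size_f.
  apply/polyP=> i; rewrite coef_comp_poly_Xn ?n_gt0 // coef_poly.
  case: ifP => ni; last first.
    by apply/esym/eqP; apply: contraFT ni => /fn.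
  rewrite divnK //; case: ltnP => // si; rewrite nth_default //.
  by apply: leq_trans si (leq_div _ _).
have gN : g`_N = 1.
  have := f_monic; rewrite monicE /lead_coef size_f /= => /eqP fN.
  rewrite coef_poly ltnSn fN size_poly1; apply/polyP=> i.
  by rewrite coef_poly !coef1; case: i.
have sg : size g = N.+1.
  apply/eqP; rewrite eqn_leq size_poly /= ltnNge; apply/negP => sg.
  by move: gN; rewrite nth_default // => /esym/eqP; rewrite oner_eq0.
by exists g; split=> //; rewrite monicE /lead_coef sg /= gN.
Qed.

Lemma f_vge : vge b f.[y].
Proof.
have [c hc] := contact_fun; rewrite horner_f.
by case: (lead_prod (fun k (_ : true) => (hc k).2)).
Qed.

(* Reduce modulo the equation of the truncated branch, which has order [b] along the branch. *)
Lemma value_small A B m : (m < b)%N ->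
  vge m (form_at y A B) -> (form_at y A B)`_m != 0 -> value m.
Proof.
move=> mb hm m0; have [g [gmon sg gf]] := f_descent.
have red C : exists C' : {poly {poly F}}, (size C' <= N)%N /\ vge b (ev y C - ev y C').
  exists (Pdiv.Ring.rmodp C g); split.
    by rewrite -ltnS -sg Pdiv.Ring.ltn_rmodpN0 // monic_neq0.
  rewrite [in ev y C](Pdiv.RingMonic.rdivp_eq gmon C) /ev rmorphD rmorphM /= gf.
  rewrite hornerD hornerM addrK; exact: vgeM (vge0 _) f_vge.
have [A' [sA' hA]] := red A; have [B' [sB' hB]] := red B.
have h : vge b (form_at y A B - form_at y A' B').
  rewrite -formB /form_at !evB.
  by apply: vgeD; rewrite -[b]addn0; apply: vgeM.
have hk k : (k < b)%N -> (form_at y A' B')`_k = (form_at y A B)`_k.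
  by move=> /h; rewrite coefB => /eqP; rewrite subr_eq0 => /eqP.
exists A', B'; split=> //; last by rewrite hk.
by move=> k km; rewrite hk ?hm // (ltn_trans km).
Qed.

Lemma value_gt0 v : value v -> (0 < v)%N.
Proof.
case=> A [B [_ _ _]]; apply: contraNltn; rewrite leqn0 => /eqP ->.
rewrite /form_at coefD coef0M coefMn coefXn (ltn_eqF n_gt0) mul0rn mulr0.
by rewrite coef0M coef_theta mulr0n mulr0 addr0.
Qed.


End Duality.

(** * Contacts with the truncations of the branch *)

Section Puiseux.
Variable F : numFieldType.
Variables (n g : nat) (beta : nat -> nat) (z : F) (y : {poly F}).
Hypothesis n_gt0 : (0 < n)%N.
Hypothesis zprim : n.-primitive_root z.
Hypothesis beta1_gt0 : (0 < beta 1)%N.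
Hypothesis y_small : forall k, (k < beta 1)%N -> y`_k = 0.
Hypothesis y_char : forall j, (1 <= j <= g)%N ->
  y`_(beta j) != 0 /\ ~~ (char_e n beta j.-1 %| beta j)%N /\
  (forall k, (k < beta j)%N -> y`_k != 0 -> (char_e n beta j.-1 %| k)%N).

Local Notation E := (char_e n beta).
Let Nn j := (n %/ E j)%N.

Lemma E_gt0 j : (0 < E j)%N.
Proof. by elim: j => //= j IH; rewrite gcdn_gt0 IH. Qed.

Lemma E_dvd i j : (i <= j)%N -> (E j %| E i)%N.
Proof.
move=> /subnKC <-; elim: (j - i)%N => [|k IH]; first by rewrite addn0.
by rewrite addnS /=; apply: dvdn_trans IH; apply: dvdn_gcdl.
Qed.

Lemma E_dvd_n j : (E j %| n)%N. Proof. exact: (E_dvd (leq0n j)). Qed.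

Lemma E_dvd_beta i j : (0 < i <= j)%N -> (E j %| beta i)%N.
Proof.
case: i => // i /andP[_ ij]; apply: dvdn_trans (E_dvd ij) _.
exact: dvdn_gcdr.
Qed.

Lemma NnE j : n = (E j * Nn j)%N.
Proof. by rewrite mulnC divnK // E_dvd_n. Qed.

Lemma Nn_gt0 j : (0 < Nn j)%N.
Proof. by rewrite divn_gt0 ?E_gt0 // dvdn_leq // E_dvd_n. Qed.

Lemma Nn_dvd j i : (Nn j %| i)%N = (n %| i * E j)%N.
Proof. by rewrite -(dvdn_pmul2r (E_gt0 j)) [(Nn j * _)%N]mulnC -NnE. Qed.

Lemma Nn0 : Nn 0 = 1%N. Proof. by rewrite /Nn divnn n_gt0. Qed.

Lemma NnS j : Nn j.+1 = (Nn j * char_n n beta j.+1)%N.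
Proof.
apply/eqP; rewrite -(eqn_pmul2l (E_gt0 j.+1)) -NnE mulnCA [(E j.+1 * _)%N]mulnC.
by rewrite /char_n divnK ?E_dvd // mulnC -NnE.
Qed.

(** If [beta j.+1] were smaller than [beta j], it would be an exponent of the branch divisible by
    [E j.-1], hence by [E j], which is excluded. *)
Lemma beta_ltS j : (0 < j)%N -> (j < g)%N -> (beta j < beta j.+1)%N.
Proof.
move=> j0 jg; have [|_ [nd yj]] := @y_char j; first by rewrite j0 ltnW.
have [yj1 [nd1 _]] := @y_char j.+1 jg.
rewrite ltn_neqAle; apply/andP; split.
  by apply: contraNneq nd1 => <-; apply: E_dvd_beta; rewrite j0 /=.
rewrite leqNgt; apply: contra nd1 => lt /=.
by apply: dvdn_trans (yj _ lt yj1); apply: E_dvd; case: (j) j0.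
Qed.

Lemma beta_lt i j : (0 < i)%N -> (i < j)%N -> (j <= g)%N -> (beta i < beta j)%N.
Proof.
move=> i0; elim: j => // j IH; rewrite ltnS leq_eqVlt => /predU1P[<-|ij] jg.
  exact: beta_ltS.
by apply: ltn_trans (IH ij (ltnW jg)) (beta_ltS _ jg); apply: leq_trans ij.
Qed.

(* The order of contact of the branch with the i-th conjugate of its truncation below [beta j.+1]. *)
Fixpoint ctc j i := if j is j'.+1 then
    (if (Nn j %| i)%N then beta j.+1 else ctc j' i) else beta 1.

Lemma ctc_dvd j i : (Nn j %| i)%N -> ctc j i = beta j.+1.
Proof. by case: j => //= j ->. Qed.

Lemma ctcP j i : ~~ (Nn j %| i)%N -> exists2 l,
  (0 < l <= j)%N & [/\ (Nn l.-1 %| i)%N, ~~ (Nn l %| i)%N & ctc j i = beta l].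
Proof.
elim: j => [|j IH] nd; first by rewrite Nn0 dvd1n in nd.
rewrite /= (negPf nd); have [d|/IH[l /andP[l0 lj] [h1 h2 h3]]] := boolP (Nn j %| i)%N.
  by exists j.+1; rewrite ?leqnn //; split=> //; rewrite ctc_dvd.
by exists l; rewrite ?l0 ?ltnS ?(ltnW lj) // leqW.
Qed.

Definition trunc j : {poly F} := \poly_(k < beta j.+1) y`_k.

Lemma coef_trunc j k : (trunc j)`_k = if (k < beta j.+1)%N then y`_k else 0.
Proof. by rewrite coef_poly. Qed.

Lemma trunc_e j : (j < g)%N -> inXe (E j) (trunc j).
Proof.
move=> jg k; rewrite coef_trunc; case: ifP => [kb|_]; last by rewrite eqxx.
by have [_ [_]] := @y_char j.+1 jg; apply.
Qed.

Lemma trunc_coef0 j : (trunc j)`_0 = 0.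
Proof. by rewrite coef_trunc y_small // if_same. Qed.

(** With [l] from [ctcP], the exponents of the branch below [beta l] are multiples of [E l.-1],
    where the action of [z ^+ i] is trivial; at [beta l] it is not. The series [p] will be the
    branch or its truncation. *)
Lemma contact_conj j i (p : {poly F}) : (j < g)%N -> ~~ (Nn j %| i)%N ->
  (forall k, (k < beta j.+1)%N -> p`_k = y`_k) ->
  exists2 c, c != 0 & lead (ctc j i) c (p - rescale (z ^+ i) (trunc j)).
Proof.
move=> jg /ctcP[l /andP[l0 lj] [d nd ->]] hp.
have lg : (l <= g)%N by apply: leq_trans lj (ltnW jg).
have [|yl [_ yk]] := @y_char l; first by rewrite l0.
have bl : (beta l < beta j.+1)%N by apply: beta_lt.
exists (y`_(beta l) * (1 - z ^+ (i * beta l))).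
  rewrite mulf_neq0 // subr_eq0 eq_sym -(prim_order_dvd zprim).
  apply: contra nd => h; rewrite Nn_dvd; move: d; rewrite Nn_dvd => d.
  (* If [n] divided both [i * E l.-1] and [i * beta l], it would divide [i * E l]. *)
  by case: (l) l0 h d => // l' _ h d /=; rewrite muln_gcdr dvdn_gcd d.
split=> [k kl|]; rewrite coefB coef_rescale coef_trunc; last first.
  by rewrite bl hp // -exprM; ring.
have kb := ltn_trans kl bl; rewrite kb hp // -exprM.
have [->|/(yk _ kl) ek] := eqVneq y`_k 0; first by rewrite mulr0 subr0.
suff /eqP -> : z ^+ (i * k) == 1 by rewrite mul1r subrr.
rewrite -(prim_order_dvd zprim); move: d; rewrite Nn_dvd => /dvdn_trans; apply.
exact: dvdn_mul.
Qed.

Lemma contact_self j i : (j < g)%N -> (Nn j %| i)%N ->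
  exists2 c, c != 0 & lead (ctc j i) c (y - rescale (z ^+ i) (trunc j)).
Proof.
move=> jg d; rewrite ctc_dvd // (inXe_rescale (trunc_e jg)); last first.
  by apply/eqP; rewrite -exprM -(prim_order_dvd zprim) -Nn_dvd.
have [yb _] := @y_char j.+1 jg; exists y`_(beta j.+1) => //.
split=> [k kb|]; rewrite coefB coef_trunc ?kb ?subrr //.
by rewrite ltnn subr0.
Qed.

(** * Character sums of the contact orders *)

Lemma sum_periodic (u : F) (h : nat -> F) m q :
  (forall i, h (i + m)%N = h i) ->
  \sum_(i < m * q) u ^+ i * h i
  = (\sum_(i < m) u ^+ i * h i) * (\sum_(k < q) (u ^+ m) ^+ k).
Proof.
move=> per; have per' i k : h (i + m * k)%N = h i.
  by elim: k => [|k IH]; rewrite ?muln0 ?addn0 // mulnS addnCA addnC per IH.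
elim: q => [|q IH]; first by rewrite muln0 !big_ord0 mulr0.
rewrite mulnSr big_split_ord /= IH big_ord_recr /= mulrDr; congr (_ + _).
rewrite mulr_suml; apply: eq_bigr => i _.
by rewrite addnC per' exprD -exprM; ring.
Qed.

Lemma sum_root (v : F) q : v ^+ q = 1 ->
  \sum_(k < q) v ^+ k = if v == 1 then q%:R else 0.
Proof.
move=> vq; have [->|v1] := eqVneq.
  by under eq_bigr do rewrite expr1n; rewrite sumr_const card_ord.
apply/eqP; have /eqP := subrX1 v q; rewrite vq subrr eq_sym mulf_eq0.
by rewrite subr_eq0 (negPf v1).
Qed.

Lemma ctc_per j i : ctc j (i + Nn j) = ctc j i.
Proof.
have h k l : (k <= j)%N -> (Nn k %| l + Nn j)%N = (Nn k %| l)%N.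
  move=> kj; rewrite dvdn_addl // Nn_dvd mulnC [X in (X %| _)%N](NnE j).
  by rewrite dvdn_pmul2r ?Nn_gt0 // E_dvd.
have : (j <= j)%N by []; elim: {1 3 5}j => // k IH kj.
by rewrite /= h // IH // ltnW.
Qed.

(** Below [Nn j.+1] the contact orders of the levels [j] and [j.+1] differ only at [i = 0]. The sum
    for level [j] over this longer range factors by periodicity. *)
Lemma ctc_sumS j (u : F) : (j.+1 < g)%N -> u ^+ Nn j.+1 = 1 ->
  \sum_(i < Nn j.+1) u ^+ i * (ctc j.+1 i)%:R =
  (beta j.+2)%:R - (beta j.+1)%:R + (\sum_(i < Nn j) u ^+ i * (ctc j i)%:R) *
    (if u ^+ Nn j == 1 then (char_n n beta j.+1)%:R else 0).
Proof.
move=> jg uN; rewrite -sum_root; last by rewrite -exprM -NnS.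
rewrite -(@sum_periodic u (fun i => (ctc j i)%:R)) => [|i]; last by rewrite ctc_per.
rewrite -NnS.
have : forall i, (0 < i < Nn j.+1)%N -> ctc j.+1 i = ctc j i.
  move=> i /andP[i0 iN] /=; case: ifP => // /dvdn_leq.
  by move=> /(_ i0); rewrite leqNgt iN.
have := ctc_dvd (dvdn0 (Nn j.+1)); have := ctc_dvd (dvdn0 (Nn j)).
case: (Nn j.+1) (Nn_gt0 j.+1) => // N _ h0 hS0 hi.
rewrite !big_ord_recl h0 hS0 expr0 !mul1r addrA subrK; congr (_ + _).
by apply: eq_bigr => i _; rewrite hi //; apply: ltn_ord.
Qed.

Lemma betabarSS j :
  betabar n beta j.+2 =
  (char_n n beta j.+1 * betabar n beta j.+1 + beta j.+2 - beta j.+1)%N.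
Proof. by []. Qed.

(** In the recursion [ctc_sumS] the increment of [beta] is positive and the other term nonnegative.
    For [u = 1] it becomes the recursion of [betabar]. *)
Lemma ctc_sum j : (j < g)%N ->
  (forall u : F, u ^+ Nn j = 1 -> 0 < \sum_(i < Nn j) u ^+ i * (ctc j i)%:R) /\
  (\sum_(i < Nn j) ctc j i)%N = betabar n beta j.+1.
Proof.
elim: j => [|j IH] jg.
  rewrite Nn0; split=> [u _|]; rewrite big_ord_recl big_ord0 ?addn0 //.
  by rewrite addr0 mul1r ltr0n.
have [pos sumE] := IH (ltnW jg); have blt := @beta_ltS j.+1 isT jg; split.
  move=> u uN; rewrite ctc_sumS // ltr_wpDr //; last by rewrite subr_gt0 ltr_nat.
  case: eqP => [uj|_]; last by rewrite mulr0.
  by rewrite mulr_ge0 ?ler0n // ltW // pos.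
have sum1 m (G : nat -> nat) :
    \sum_(i < m) 1 ^+ i * (G i)%:R = (\sum_(i < m) G i)%:R :> F.
  by rewrite natr_sum; apply: eq_bigr => i _; rewrite expr1n mul1r.
have := @ctc_sumS j 1 jg (expr1n _ _).
rewrite !sum1 expr1n eqxx sumE -natrB 1?ltnW // -natrM -natrD betabarSS.
by move=> /eqP; rewrite eqr_nat => /eqP ->; rewrite -addnBA 1?ltnW // addnC mulnC.
Qed.

Lemma betabar_e j : (0 < j <= g)%N -> (E j %| betabar n beta j)%N.
Proof.
case: j => //; elim=> [|j IH] jg; first exact: E_dvd_beta.
rewrite betabarSS dvdn_sub ?dvdn_addl ?E_dvd_beta ?leqnn ?leqnSn //.
apply: dvdn_mull; apply: dvdn_trans (E_dvd (leqnSn _)) _.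
by apply: IH; apply: ltnW.
Qed.

Lemma char_n_gt0 j : (0 < char_n n beta j)%N.
Proof. by rewrite divn_gt0 ?E_gt0 // dvdn_leq ?E_gt0 // E_dvd // leq_pred. Qed.

Lemma betabar_le j : (0 < j < g)%N -> (betabar n beta j <= betabar n beta j.+1)%N.
Proof.
case: j => // j jg; rewrite betabarSS -addnBA; last by rewrite ltnW // beta_ltS.
apply: leq_trans (leq_addr _ _).
apply: leq_pmull; exact: char_n_gt0.
Qed.

Lemma betabar_mono j k : (0 < j)%N -> (j <= k)%N -> (k <= g)%N ->
  (betabar n beta j <= betabar n beta k)%N.
Proof.
move=> j0; elim: k => [|k IH]; first by rewrite leqn0 => /eqP jE; rewrite jE in j0.
rewrite leq_eqVlt => /predU1P[-> //|jk] kg.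
apply: leq_trans (IH jk (ltnW kg)) (betabar_le _).
by rewrite kg andbT (leq_trans j0 jk).
Qed.

(** * Values of arbitrary forms along the branch and their translation *)

Definition branch_value m := exists A B,
  vge m (form_at n y A B) /\ (form_at n y A B)`_m != 0.

Definition trunc_value j := value n (Nn j).-1 y.

Lemma trunc_value_branch j v : trunc_value j v -> branch_value v.
Proof. by case=> A [B [_ _ hv v0]]; exists A, B. Qed.

Lemma truncation_facts j : (j < g)%N ->
  [/\ forall v v', trunc_value j v -> trunc_value j v' -> (v + v' != betabar n beta j.+1)%N,
      forall v, (E j %| v)%N -> (v <= betabar n beta j.+1)%N -> ~ trunc_value j v ->
        trunc_value j (betabar n beta j.+1 - v)%N,
      forall m, (m < betabar n beta j.+1)%N -> branch_value m -> trunc_value j m &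
      forall v, trunc_value j v ->
        (0 < v)%N /\ ((E j %| v)%N \/ (beta j.+1 <= v)%N /\ (E j %| v - beta j.+1)%N)].
Proof.
move=> jg; have N0 : (Nn j).-1.+1 = Nn j := prednK (Nn_gt0 j).
have nE : n = (E j * (Nn j).-1.+1)%N by rewrite N0; apply: NnE.
have [pos sumE] := ctc_sum jg.
have lam0 : ctc j 0 = beta j.+1 by apply: ctc_dvd; apply: dvdn0.
have nd i : (0 < i < (Nn j).-1.+1)%N -> ~~ (Nn j %| i)%N.
  rewrite N0 => /andP[i0 iN]; apply/negP => /(dvdn_leq i0).
  by rewrite leqNgt iN.
have lam_lt i : (0 < i < (Nn j).-1.+1)%N -> (ctc j i < beta j.+1)%N.
  by move=> /nd /ctcP[l /andP[l0 lj] [_ _ ->]]; apply: beta_lt.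
have lam_e i : (0 < i < (Nn j).-1.+1)%N -> (E j %| ctc j i)%N.
  by move=> /nd /ctcP[l lj [_ _ ->]]; apply: E_dvd_beta.
have beta_e : ~~ (E j %| beta j.+1)%N by have [_ []] := @y_char j.+1 jg.
have contact i : (i < (Nn j).-1.+1)%N ->
    exists2 c, c != 0 & lead (ctc j i) c (y - rescale (z ^+ i) (trunc j)).
  move=> _; have [d|d] := boolP (Nn j %| i)%N; first exact: contact_self.
  exact: contact_conj.
have contactj i : (0 < i < (Nn j).-1.+1)%N ->
    exists2 c, c != 0 & lead (ctc j i) c (trunc j - rescale (z ^+ i) (trunc j)).
  by move=> /nd d; apply: contact_conj => // k kb; rewrite coef_trunc kb.
have lam_pos (u : F) : u ^+ (Nn j).-1.+1 = 1 ->
    \sum_(i < (Nn j).-1.+1) u ^+ i * (ctc j i)%:R != 0.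
  by rewrite N0 => /pos /lt0r_neq0.
have <- : (\sum_(i < (Nn j).-1.+1) ctc j i)%N = betabar n beta j.+1 by rewrite N0.
split.
- exact: (value_dual (E_gt0 j) nE zprim (trunc_e jg) (trunc_coef0 j) lam0
    lam_lt lam_e beta_e contact contactj lam_pos).
- exact: (value_codual (E_gt0 j) nE zprim (trunc_e jg) (trunc_coef0 j) lam0
    lam_lt lam_e beta_e contact contactj lam_pos).
- move=> m mb [A [B [hm m0]]]; move: hm m0.
  exact: (value_small (E_gt0 j) nE zprim (trunc_e jg) contact).
move=> v hv; split; first exact: (value_gt0 (E_gt0 j) nE hv).
exact: (value_dvd_or (E_gt0 j) nE zprim (trunc_e jg) lam0
    lam_lt lam_e beta_e contact contactj lam_pos hv).
Qed.

(** The target is [betabar] at [j.+1] minus the difference of [betabar] at [j] and [m]. By duality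
    at level [j] it is enough that this difference is not a value there; otherwise it and [m] would
    violate duality at level [j.-1]. *)
Lemma branch_value_step m j : (0 < j < g)%N -> branch_value m ->
  (m <= betabar n beta j)%N ->
  branch_value (m + betabar n beta j.+1 - betabar n beta j)%N.
Proof.
case: j => // j /andP[_ jg] hm mb; have ble := @betabar_le j.+1 jg.
have [dual' _ small' dvd'] := truncation_facts (ltnW jg).
have [_ codual _ gt0] := truncation_facts jg.
have -> : (m + betabar n beta j.+2 - betabar n beta j.+1
   = betabar n beta j.+2 - (betabar n beta j.+1 - m))%N by lia.
apply/trunc_value_branch/codual; first 1 last.
- by apply: leq_trans ble; apply: leq_subr.
(* When [m] equals [betabar] the assumption [h] would make 0 a value. *)
- move=> h; have [m0|mlt] : (m = betabar n beta j.+1 \/ m < betabar n beta j.+1)%N.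
  + by lia.
  + by have [] := gt0 _ h; rewrite m0 subnn.
  have hm' := small' _ mlt hm; have [mgt0 _] := dvd' _ hm'.
  have /small' : (betabar n beta j.+1 - m < betabar n beta j.+1)%N by lia.
  move=> /(_ (trunc_value_branch h)) h'.
  by case/eqP: (dual' _ _ hm' h'); rewrite subnKC.
have be : (E j.+1 %| betabar n beta j.+1)%N by apply: betabar_e; apply: ltnW.
apply: dvdn_sub => //.
have [-> |mlt] : (m = betabar n beta j.+1 \/ m < betabar n beta j.+1)%N by lia.
  exact: be.
(* A value of level [j] is congruent to 0 or [beta j.+1] modulo [E j], and [E j.+1] divides all
   three numbers. *)
have [_ [d|[bm d]]] := dvd' _ (small' _ mlt hm).
  by apply: dvdn_trans d; apply: E_dvd.
rewrite -(subnK bm) dvdn_addl ?E_dvd_beta ?leqnn //.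
by apply: dvdn_trans d; apply: E_dvd.
Qed.

(** The translate at stage [k] is at most [betabar] at [k], so [branch_value_step] can be
    iterated. *)
Lemma branch_value_shift m j k : (0 < j)%N -> (j <= k <= g)%N -> branch_value m ->
  (m <= betabar n beta j)%N ->
  branch_value (m + betabar n beta k - betabar n beta j)%N.
Proof.
move=> j0 /andP[jk kg] hm mb; elim: k jk kg => [|k IH].
  by rewrite leqn0 => /eqP jE; rewrite jE in j0.
rewrite leq_eqVlt => /predU1P[<-|jk] kg; first by rewrite addnK.
have kg' : (0 < k < g)%N by rewrite kg andbT (leq_trans j0 jk).
have le : (betabar n beta j <= betabar n beta k)%N.
  by apply: betabar_mono => //; apply: ltnW.
have := branch_value_step kg' (IH jk (ltnW kg)).
have -> : (m + betabar n beta k - betabar n beta j + betabar n beta k.+1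
   - betabar n beta k = m + betabar n beta k.+1 - betabar n beta j)%N.
  by have := betabar_le kg'; lia.
by apply; lia.
Qed.
End Puiseux.

(** * From power series to polynomials *)

(** In characteristic 0 the polynomial X^n - 1 is separable, so there are n distinct n-th roots of
    unity, one of them primitive. *)
Lemma prim_root_exists (F : numClosedFieldType) (n : nat) : (0 < n)%N ->
  exists z : F, n.-primitive_root z.
Proof.
move=> n0; have [rs hrs] := closed_field_poly_normal ('X^n - 1 : {poly F}).
have hp : 'X^n - 1 = \prod_(r <- rs) ('X - r%:P) :> {poly F}.
  by rewrite hrs lead_coefDl ?lead_coefXn ?scale1r // size_polyXn size_polyN size_poly1 ltnS.
have /hasP[z _ hz] : has n.-primitive_root rs.
  apply: has_prim_root => //.
  - apply/allP => r rin; rewrite /root_of_unity hp root_prod_XsubC //.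
  - rewrite -separable_prod_XsubC -hp; apply: cyclotomic.separable_Xn_sub_1.
    by rewrite pnatr_eq0 -lt0n.
  have := congr1 (fun p : {poly F} => size p) hp; rewrite size_prod_XsubC.
  rewrite size_polyDl ?size_polyXn ?size_polyN ?size_poly1 ?ltnS //.
  by move=> [->].
by exists z.
Qed.

Section Bridge.
Variable R : realType.
Local Notation C := R[i].
Implicit Types (f : ps R) (p q r x : {poly C}) (a b : ps2 R) (A B : {poly {poly C}}).

Definition agree K f p := forall k, (k <= K)%N -> f k = p`_k.
Definition agree2 K a A := forall i j, (i <= K)%N -> (j <= K)%N -> a i j = (A`_j)`_i.

Lemma agree_le K L f p : (K <= L)%N -> agree L f p -> agree K f p.
Proof. by move=> KL h k kK; apply: h; apply: leq_trans KL. Qed.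

Lemma ps_mul_agree K f p f' p' : agree K f p -> agree K f' p' ->
  agree K (ps_mul f f') (p * p').
Proof.
move=> h h' k kK; rewrite /ps_mul coefM; apply: eq_bigr => i _.
by rewrite h ?h' // (leq_trans _ kK) ?leq_subr // -ltnS.
Qed.

Lemma ps_exp_agree K f p m : agree K f p -> agree K (ps_exp f m) (p ^+ m).
Proof.
move=> h; elim: m => [|m IH]; first by move=> k _; rewrite coef1.
by rewrite exprS; apply: ps_mul_agree.
Qed.

Lemma tpow_agree K n : agree K (tpow R n) 'X^n.
Proof. by move=> k _; rewrite coefXn. Qed.

Lemma vge_exp x m : x`_0 = 0 -> vge m (x ^+ m).
Proof.
move=> x0; elim: m => // m IH; rewrite exprS -add1n; apply: vgeM => //.
by case.
Qed.

(** As [x ^+ j] has order at least [j], the terms with [j > k] do not contribute; this matches the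
    finite range in [ps_subst]. *)
Lemma coef_horner_small A x r k : x`_0 = 0 ->
  (A.[x] * r)`_k = \sum_(j < k.+1) (A`_j * x ^+ j * r)`_k.
Proof.
move=> x0; rewrite (@horner_coef_wide _ (k.+1 + size A)) ?leq_addl //.
rewrite mulr_suml coef_sum big_split_ord /= [X in _ + X]big1 ?addr0 // => j _.
have h := vgeM (vgeM (@vge0 _ A`_(k.+1 + j)) (@vge_exp x (k.+1 + j) x0)) (@vge0 _ r).
by apply: h; rewrite add0n addn0 addSn ltnS leq_addr.
Qed.

Lemma coef_comp_small p x r k : x`_0 = 0 ->
  ((p \Po x) * r)`_k = \sum_(i < k.+1) p`_i * (x ^+ i * r)`_k.
Proof.
move=> x0; rewrite [p \Po x]/(_.[x]) coef_horner_small //; apply: eq_bigr => i _.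
by rewrite coef_map /= -mulrA coefCM.
Qed.

Lemma ps_subst_agree n K a A (y : ps R) p : (0 < n)%N -> p`_0 = 0 ->
  agree2 K a A -> agree K y p -> agree K (ps_subst a (tpow R n) y) (ev n p A).
Proof.
move=> n0 p0 haA hy k kK; rewrite /ps_subst exchange_big /=.
rewrite -[ev n p A]mulr1 coef_horner_small //; apply: eq_bigr => j _.
rewrite mulr1 coef_map /= coef_comp_small; last by rewrite coefXn ltn_eqF.
apply: eq_bigr => i _; rewrite haA; last first.
- by apply: leq_trans kK; rewrite -ltnS.
- by apply: leq_trans kK; rewrite -ltnS.
congr (_ * _); apply: ps_mul_agree (kK) => //.
  by apply: ps_exp_agree; apply: tpow_agree.
exact: ps_exp_agree.
Qed.

Lemma ps_deriv_agree K f p : agree K.+1 f p -> agree K (ps_deriv f) p^`().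
Proof. by move=> h k kK; rewrite /ps_deriv h ?coef_deriv. Qed.

(** Working with dt/t instead of dt multiplies by t, which accounts for the shift from [o] to
    [o.+1]. The derivative of [y] requires agreement one order further. *)
Lemma form_agree n K a A b B (y : ps R) p : (0 < n)%N -> p`_0 = 0 ->
  agree2 K a A -> agree2 K b B -> agree K.+1 y p ->
  forall o, (o <= K)%N ->
  ps_add (ps_mul (ps_subst a (tpow R n) y) (ps_deriv (tpow R n)))
         (ps_mul (ps_subst b (tpow R n) y) (ps_deriv y)) o
  = (form_at n p A B)`_o.+1.
Proof.
move=> n0 p0 haA hbB hy o oK; have hy' := agree_le (leqnSn K) hy.
have -> : form_at n p A B = 'X * (ev n p A * 'X^n^`() + ev n p B * p^`()).
  have -> : form_at n p A B = ev n p A * ('X * 'X^n^`()) + ev n p B * theta p.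
    by rewrite derivXn mulrnAr -exprS prednK.
  by rewrite /theta; ring.
rewrite coefXM /= coefD /ps_add; congr (_ + _); apply: ps_mul_agree (oK).
- exact: ps_subst_agree.
- by apply: ps_deriv_agree; apply: tpow_agree.
- exact: ps_subst_agree.
exact: ps_deriv_agree.
Qed.

Definition poly_of_ps2 K a : {poly {poly C}} := \poly_(j < K.+1) \poly_(i < K.+1) a i j.

Lemma poly_of_ps2_agree K a : agree2 K a (poly_of_ps2 K a).
Proof. by move=> i j iK jK; rewrite coef_poly ltnS jK coef_poly ltnS iK. Qed.

Lemma convergent2_poly A : convergent2 (fun i j => (A`_j)`_i).
Proof.
exists 1, (\sum_(j < size A) \sum_(i < size A`_j) `|(A`_j)`_i|); split=> // i j.
rewrite expr1n mulr1.
have nn (j' : 'I_(size A)) : 0 <= \sum_(i < size A`_j') `|(A`_j')`_i| by apply: sumr_ge0.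
case: (ltnP j (size A)) => jA; last first.
  by rewrite [A`_j]nth_default // coef0 normr0 sumr_ge0.
case: (ltnP i (size A`_j)) => iA; last first.
  by rewrite nth_default // normr0 sumr_ge0.
rewrite (bigD1 (Ordinal jA)) //= (bigD1 (Ordinal iA)) //= -addrA lerDl.
by apply: addr_ge0; apply: sumr_ge0 => l _; [exact: normr_ge0 | exact: nn].
Qed.

(** Whether [m] is a value depends on finitely many coefficients, so the series can be truncated.
    Conversely polynomial forms are convergent. *)
Lemma diff_values_branch n (y : ps R) p m : (0 < n)%N -> p`_0 = 0 -> agree m y p ->
  diff_values n y m <-> branch_value n p m.
Proof.
move=> n0 p0 hy; split.
  case=> a [b [_ [_ [o [mE [ho0 ho]]]]]]; move: hy; rewrite mE => hy.
  exists (poly_of_ps2 o a), (poly_of_ps2 o b).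
  have h := form_agree n0 p0 (@poly_of_ps2_agree o a) (@poly_of_ps2_agree o b) hy.
  split; last by rewrite -h.
  case=> [|i]; last by rewrite ltnS => io; rewrite -h ?ho // ltnW.
  by rewrite /form_at /theta coefD coef0M coefMn coefXn ltn_eqF // mul0rn mulr0 coef0M coefXM mulr0 addr0.
case=> A [B [hv v0]]; exists (fun i j => (A`_j)`_i), (fun i j => (B`_j)`_i).
split; [exact: convergent2_poly | split; first exact: convergent2_poly].
have m0 : (0 < m)%N.
  case: (m) v0 => //; rewrite /form_at /theta coefD coef0M coefMn coefXn ltn_eqF //.
  by rewrite mul0rn mulr0 coef0M coefXM mulr0 addr0 eqxx.
have hy' : agree m.-1.+1 y p by rewrite prednK.
have h := @form_agree n m.-1 _ A _ B y p n0 p0 (fun _ _ _ _ => erefl) (fun _ _ _ _ => erefl) hy'.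
exists m.-1; split; first by rewrite prednK.
split; first by rewrite h // prednK.
by move=> i im; rewrite (h i (ltnW im)); apply: hv; rewrite -(prednK m0).
Qed.

Lemma semigroup_poly n (y : ps R) p s : (0 < n)%N -> p`_0 = 0 -> agree s y p ->
  semigroup n y s -> exists P, vge s (ev n p P) /\ (ev n p P)`_s != 0.
Proof.
move=> n0 p0 hy [f [_ [_ [fs f0]]]]; exists (poly_of_ps2 s f).
have h := ps_subst_agree n0 p0 (@poly_of_ps2_agree s f) hy.
by split=> [i si|]; [rewrite -h ?f0 // ltnW | rewrite -h].
Qed.

End Bridge.

Lemma branch_valueM (F : numFieldType) n (y : {poly F}) (P : {poly {poly F}}) m s :
  branch_value n y m -> vge s (ev n y P) -> (ev n y P)`_s != 0 ->
  branch_value n y (m + s)%N.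
Proof.
move=> [A [B [hm m0]]] hs s0; exists (P * A), (P * B).
have -> : form_at n y (P * A) (P * B) = form_at n y A B * ev n y P.
  rewrite /form_at /ev !rmorphM !hornerM /theta; move: ('X^n *+ n) => ?; ring.
have [h1 h2] := leadM (vge_lead hm) (vge_lead hs).
by split=> //; rewrite h2 mulf_neq0.
Qed.

Theorem theorem1p1 (R : realType) (n : nat) (y : ps R) (g : nat)
    (beta : nat -> nat) :
  (2 <= n)%N ->
  convergent y ->
  puiseux_char_exps n y g beta ->
  (n < beta 1%N)%N ->
  (forall k, (k < beta 1%N)%N -> y k = 0) ->
  (forall m s, diff_values n y m -> semigroup n y s -> diff_values n y (m + s)%N)
  /\
  (forall m j k, diff_values n y m -> (1 <= j)%N -> (j <= k)%N -> (k <= g)%N ->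
     (m <= betabar n beta j)%N ->
     diff_values n y (m + betabar n beta k - betabar n beta j)%N).
Proof.
move=> n2 _ [g1 [_ ychar]] nb ysmall; have n0 : (0 < n)%N by apply: ltnW.
have b0 : (0 < beta 1)%N by apply: leq_ltn_trans nb.
pose p M : {poly R[i]} := \poly_(k < M.+1) y k.
have hp M : agree M y (p M) by move=> k kM; rewrite coef_poly ltnS kM.
have p0 M : (p M)`_0 = 0 by rewrite coef_poly ysmall.
have br M m : (m <= M)%N -> diff_values n y m <-> branch_value n (p M) m.
  by move=> mM; apply: diff_values_branch => //; apply: agree_le (hp M).
split=> [m s hm hs|m j k hm j1 jk kg mb].
  have [P [hv v0]] := semigroup_poly n0 (p0 _) (agree_le (leq_addl m s) (hp _)) hs.
  by apply/(br (m + s)%N) => //; apply: branch_valueM hv v0; apply/br => //; apply: leq_addr.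
have [z zprim] := @prim_root_exists R[i] n n0.
(* This truncation order is at least both values in question and all the exponents [beta i] with
   [i <= g]. *)
pose M := (m + betabar n beta k + \sum_(i < g.+1) beta i)%N.
have bM i : (i <= g)%N -> (beta i <= M)%N.
  rewrite -ltnS => ig; apply: leq_trans (leq_addl _ _).
  by rewrite (bigD1 (Ordinal ig)) //= leq_addr.
have ysm i : (i < beta 1)%N -> (p M)`_i = 0.
  by move=> ib; rewrite -hp ?ysmall // (leq_trans (ltnW ib)) // bM.
have ych i : (1 <= i <= g)%N -> (p M)`_(beta i) != 0 /\
    ~~ (char_e n beta i.-1 %| beta i)%N /\
    (forall l, (l < beta i)%N -> (p M)`_l != 0 -> (char_e n beta i.-1 %| l)%N).
  move=> ig; have [y1 [y2 y3]] := ychar i ig; have /bM hi : (i <= g)%N by case/andP: ig.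
  by split; [rewrite -hp | split=> // l li; rewrite -hp ?(leq_trans (ltnW li)) //; apply: y3].
apply/(br M); first by rewrite /M; lia.
apply: (branch_value_shift n0 zprim b0 ysm ych) => //; first by rewrite jk.
by apply/br => //; rewrite /M; lia.
Qed.
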